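(* Let $\triangle PQR$ be a (closed, filled) triangle contained in $D$ such that either $\Delta_2'(P,Q)\leq \delta(P,Q,R)\leq \tfrac{1}{2}\Delta_1'(P,Q)$ or $\tfrac{1}{2}\Delta_1'(P,Q)\leq \delta(P,Q,R)\leq \Delta_2'(P,Q)$. Then $\rho(\psi_{\triangle PQR})=\tfrac{2}{5}$.
   Context: $D=\{(x,y)\in\mathbb R^2: x^2+y^2<1\}$ is the open unit disk and $S^1$ its boundary circle, identified with $\mathbb R/\mathbb Z$ via the counterclockwise normalized angle; $\pi:\mathbb R\to S^1$ is the projection $x\mapsto x-\lfloor x\rfloor$. For a closed convex set $U\subset D$ and $v\in S^1$, $\psi_U(v)$ is the point $w\in S^1\setminus\{v\}$ such that the line $vw$ meets $U$ and $U$ lies in the closed half-plane to the left of the directed line from $v$ to $w$ (equivalently, among the points $w$ with chord $vw$ tangent to $U$, the one reached first going counterclockwise from $v$). $\psi_U$ is an orientation-preserving homeomorphism of $S^1$. For an orientation-preserving homeomorphism $f$ of $S^1$, $\rho(f)=\lim_{n\to\infty}(\overline f^n(x)-x)/n$ where $\overline f$ is the lift of $f$ to $\mathbb R$ with $\overline f(0)\in[0,1)$. Regard $D$ as the Beltrami–Klein model of the hyperbolic plane: hyperbolic lines are chords of $D$. For distinct $P,Q\in D$, let $v_1,v_2\in S^1$ be the endpoints of the chord through $P,Q$; define $d'(P,Q)=\tfrac12\left|\log\frac{|v_1Q||v_2P|}{|v_1P||v_2Q|}\right|$ (Euclidean lengths), and $d'(P,P)=0$. For $n\in\mathbb Z_{>0}$,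 $\Delta_n'(P,Q)=\log\frac{e^{n d'(P,Q)}+1}{e^{n d'(P,Q)}-1}$. For $P\neq Q$ and $R$ in $D$, $\delta(P,Q,R)$ is the minimum of $d'(R,S)$ over points $S$ of the chord (hyperbolic line) through $P$ and $Q$. *)

(* Defs.v *)
From Stdlib Require Import Reals Lra ClassicalEpsilon.
Open Scope R_scope.

Definition pt2 : Type := (R * R)%type.

Definition inD (p : pt2) : Prop := fst p ^ 2 + snd p ^ 2 < 1.

(** S^1 = R/Z, represented by t in [0,1); the point of the boundary circle
    with counterclockwise normalized angle t. *)
Definition circ (t : R) : pt2 := (cos (2 * PI * t), sin (2 * PI * t)).

Definition proj (x : R) : R := frac_part x.

(** cross a b c > 0 iff c lies strictly to the left of the directed line a -> b. *)
Definition cross (a b c : pt2) : R :=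
  (fst b - fst a) * (snd c - snd a) - (snd b - snd a) * (fst c - fst a).

Definition psi_spec (U : pt2 -> Prop) (v w : R) : Prop :=
  0 <= w < 1 /\ w <> v /\
  (exists p, U p /\ cross (circ v) (circ w) p = 0) /\
  (forall p, U p -> 0 <= cross (circ v) (circ w) p).

(** psi_U : S^1 -> S^1 (on representatives in [0,1)). *)
Definition psi (U : pt2 -> Prop) (v : R) : R :=
  epsilon (inhabits 0) (psi_spec U v).

Definition is_lift (f : R -> R) (F : R -> R) : Prop :=
  continuity F /\ (forall x, proj (F x) = f (proj x)) /\ 0 <= F 0 < 1.

Definition rotation_number_is (f : R -> R) (r : R) : Prop :=
  (exists F, is_lift f F) /\
  forall F, is_lift f F -> forall x : R,
    Un_cv (fun n : nat => (Nat.iter n F x - x) / INR n) r.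

Definition filled_triangle (P Q R0 : pt2) (X : pt2) : Prop :=
  exists a b c : R, 0 <= a /\ 0 <= b /\ 0 <= c /\ a + b + c = 1 /\
    fst X = a * fst P + b * fst Q + c * fst R0 /\
    snd X = a * snd P + b * snd Q + c * snd R0.

Definition edist (A B : pt2) : R :=
  sqrt ((fst A - fst B) ^ 2 + (snd A - snd B) ^ 2).

(** Endpoints on S^1 of the line through P, Q (P <> Q, P in D):
    P + t (Q - P) with |P + t(Q-P)|^2 = 1. *)
Definition chord_qa (P Q : pt2) : R := (fst Q - fst P) ^ 2 + (snd Q - snd P) ^ 2.
Definition chord_qb (P Q : pt2) : R := fst P * (fst Q - fst P) + snd P * (snd Q - snd P).
Definition chord_qc (P : pt2) : R := fst P ^ 2 + snd P ^ 2 - 1.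
Definition chord_pt (P Q : pt2) (t : R) : pt2 :=
  (fst P + t * (fst Q - fst P), snd P + t * (snd Q - snd P)).
Definition chord_end1 (P Q : pt2) : pt2 :=
  chord_pt P Q ((- chord_qb P Q - sqrt (chord_qb P Q ^ 2 - chord_qa P Q * chord_qc P))
                / chord_qa P Q).
Definition chord_end2 (P Q : pt2) : pt2 :=
  chord_pt P Q ((- chord_qb P Q + sqrt (chord_qb P Q ^ 2 - chord_qa P Q * chord_qc P))
                / chord_qa P Q).

(** Hilbert/hyperbolic distance d' in the Klein model. *)
Definition dprime (P Q : pt2) : R :=
  match Req_EM_T (fst P) (fst Q), Req_EM_T (snd P) (snd Q) with
  | left _, left _ => 0
  | _, _ =>
    let v1 := chord_end1 P Q in
    let v2 := chord_end2 P Q in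
    / 2 * Rabs (ln ((edist v1 Q * edist v2 P) / (edist v1 P * edist v2 Q)))
  end.

Definition Deltap (n : nat) (P Q : pt2) : R :=
  ln ((exp (INR n * dprime P Q) + 1) / (exp (INR n * dprime P Q) - 1)).

Definition on_chord (P Q S : pt2) : Prop :=
  inD S /\ exists t : R, S = chord_pt P Q t.

Definition is_min_dist (P Q R0 : pt2) (r : R) : Prop :=
  (exists S, on_chord P Q S /\ dprime R0 S = r) /\
  (forall S, on_chord P Q S -> r <= dprime R0 S).

Definition delta (P Q R0 : pt2) : R :=
  epsilon (inhabits 0) (is_min_dist P Q R0).

(* Main.v *)
(** In the Klein model, let [I_V] be the lift of the map sending a boundary point
    to the other end of its chord through [V]; it is the boundary action of the
    hyperbolic point reflection in [V], and the lift of [psi] for the triangle is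
    the pointwise minimum [F] of [I_P], [I_Q], [I_R].  The rotation number is 2/5
    as soon as [F^5 a <= a + 2] and [F^5 b >= b + 2] for some [a] and [b].  Let
    [N = sinh h sinh d], for [d] a side and [h] its altitude; [N] is the same for
    the three sides.

    Upper bound: [F^5 <= I_R I_Q I_P I_Q I_P], and [I_Q I_P] is a translation by
    [2d] along [PQ], so a suitable [a] exists as soon as [2 N cosh d >= 1].
    Lower bound: the orbit of an endpoint of the line [PQ] runs along [PQ], bounces
    at [R], and returns in five steps after two turns if [2 N cosh h <= 1].
    The hypotheses say that 1 lies between [2 N cosh d] and [2 N cosh h].  When
    [2 N cosh d <= 1 <= 2 N cosh h], both bounds are applied to other sides, because
    [|QR| >= h] and the altitude from [Q] is at most [|QP| = d].

    A point [V] of the disk is represented by the timelike vector [hom V = (V, 1)]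
    and a boundary point by a null vector up to a positive factor. *)

From Stdlib Require Import ZArith Reals Lra Lia Psatz ClassicalEpsilon.
Require Import Defs.
Open Scope R_scope.

(** * Lorentzian vectors *)

Definition vec : Type := (R * R * R)%type.
Definition vx (X : vec) : R := fst (fst X).
Definition vy (X : vec) : R := snd (fst X).
Definition vz (X : vec) : R := snd X.

Definition hom (P : pt2) : vec := (fst P, snd P, 1).
Definition vadd (X Y : vec) : vec := (vx X + vx Y, vy X + vy Y, vz X + vz Y).
Definition vscal (k : R) (X : vec) : vec := (k * vx X, k * vy X, k * vz X).

Definition lor (X Y : vec) : R := vz X * vz Y - vx X * vx Y - vy X * vy Y.
Definition det3 (X Y Z : vec) : R :=
  vx X * (vy Y * vz Z - vz Y * vy Z) - vy X * (vx Y * vz Z - vz Y * vx Z)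
  + vz X * (vx Y * vy Z - vy Y * vx Z).

(* Sign convention: [lor (lcross X Y) Z = - det3 X Y Z]. *)
Definition lcross (X Y : vec) : vec :=
  (vy X * vz Y - vz X * vy Y, vz X * vx Y - vx X * vz Y,
   - (vx X * vy Y - vy X * vx Y)).

(** The isometric point reflection multiplied by [lor V V]. The scaling avoids a division and is
    harmless because boundary points are rays. *)
Definition point_reflection (V X : vec) : vec :=
  vadd (vscal (2 * lor V X) V) (vscal (- lor V V) X).

Ltac vec_unfold :=
  unfold point_reflection, lcross, det3, lor, vadd, vscal, hom, vx, vy, vz in *; simpl in *.
Ltac vec_ring := intros; vec_unfold; ring.

Lemma cross_det3 (P Q S : pt2) : cross P Q S = det3 (hom P) (hom Q) (hom S).
Proof. unfold cross; vec_ring. Qed.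

Lemma lor_self_pos (P : pt2) : inD P -> 0 < lor (hom P) (hom P).
Proof. unfold inD; intros; vec_unfold; nra. Qed.

Lemma inD_of_lor_self_pos (P : pt2) : 0 < lor (hom P) (hom P) -> inD P.
Proof. unfold inD; intros; vec_unfold; lra. Qed.

Lemma lor_sym (X Y : vec) : lor X Y = lor Y X.
Proof. vec_ring. Qed.

(** Twice the product is [(1 - |P|^2) + (1 - |Q|^2) + |P - Q|^2]. *)
Lemma lor_pos (P Q : pt2) : inD P -> inD Q -> 0 < lor (hom P) (hom Q).
Proof.
  unfold inD; destruct P as [p1 p2], Q as [q1 q2]; intros; vec_unfold; simpl in *.
  pose proof (pow2_ge_0 (p1 - q1)). pose proof (pow2_ge_0 (p2 - q2)). nra.
Qed.

Lemma lor_circ_pos (P : pt2) (x : R) : inD P -> 0 < lor (hom P) (hom (circ x)).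
Proof.
  unfold inD; destruct P as [p1 p2]; intros; vec_unfold; simpl in *.
  pose proof (sin2_cos2 (2 * PI * x)) as Hsc; unfold Rsqr in Hsc.
  set (c := cos (2 * PI * x)) in *; set (s := sin (2 * PI * x)) in *.
  pose proof (pow2_ge_0 (p1 - c)). pose proof (pow2_ge_0 (p2 - s)). nra.
Qed.

Lemma lor_circ_null (x : R) : lor (hom (circ x)) (hom (circ x)) = 0.
Proof.
  vec_unfold. pose proof (sin2_cos2 (2 * PI * x)) as Hsc; unfold Rsqr in Hsc. lra.
Qed.

Lemma circ_shift (x : R) : circ (x + 1) = circ x.
Proof.
  unfold circ.
  rewrite <- (cos_period (2 * PI * x) 1), <- (sin_period (2 * PI * x) 1); simpl.
  do 2 f_equal; ring.
Qed.

Lemma unit_vector_circ (x y : R) : x ^ 2 + y ^ 2 = 1 -> exists t, circ t = (x, y).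
Proof.
  intros H. assert (Hx : -1 <= x <= 1) by (split; nra).
  assert (Hpi := PI_RGT_0).
  assert (Hc : cos (acos x) = x) by now apply cos_acos.
  assert (Hs : sin (acos x) = Rabs y).
  { rewrite sin_acos by assumption.
    replace (1 - x²) with (y²) by (unfold Rsqr; lra). apply sqrt_Rsqr_abs. }
  destruct (Rle_dec 0 y) as [Hy | Hy].
  - exists (acos x / (2 * PI)). unfold circ.
    replace (2 * PI * (acos x / (2 * PI))) with (acos x) by (field; lra).
    now rewrite Hc, Hs, Rabs_pos_eq.
  - exists (- acos x / (2 * PI)). unfold circ.
    replace (2 * PI * (- acos x / (2 * PI))) with (- acos x) by (field; lra).
    rewrite cos_neg, sin_neg, Hc, Hs, Rabs_left1 by lra. f_equal; ring.
Qed.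

Definition on_ray (x : R) (X : vec) : Prop :=
  exists k, 0 < k /\ X = vscal k (hom (circ x)).

Lemma on_ray_circ (x : R) : on_ray x (hom (circ x)).
Proof. exists 1; split; [lra | unfold vscal, hom, vx, vy, vz; simpl; f_equal; [f_equal |]; ring]. Qed.

Lemma null_vector_on_ray (X : vec) : lor X X = 0 -> 0 < vz X -> exists x, on_ray x X.
Proof.
  destruct X as [[x1 x2] x3]; intros H H3; vec_unfold.
  destruct (unit_vector_circ (x1 / x3) (x2 / x3)) as [t Ht].
  { replace ((x1 / x3) ^ 2 + (x2 / x3) ^ 2) with ((x1 * x1 + x2 * x2) / (x3 * x3)) by (field; lra).
    replace (x1 * x1 + x2 * x2) with (x3 * x3) by lra. field; lra. }
  exists t, x3; split; [assumption |]. rewrite Ht; vec_unfold.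
  f_equal; [f_equal |]; field; lra.
Qed.

(** * Chord maps *)

(** Tangent of the angle at [circ x] from the inward normal to the direction of [V], positive
    towards the counterclockwise tangent. *)
Definition slope (V : pt2) (x : R) : R :=
  (cos (2 * PI * x) * snd V - sin (2 * PI * x) * fst V)
  / (1 - cos (2 * PI * x) * fst V - sin (2 * PI * x) * snd V).

(* Lift of the circle map sending [v] to the other endpoint of the chord through
   [v] and [V]; by the inscribed angle theorem the chord turns the tangent by
   half of the arc it cuts off. *)
Definition chord_map (V : pt2) (x : R) : R := x + / 2 - atan (slope V x) / PI.

Lemma chord_map_bounds (V : pt2) (x : R) : x < chord_map V x < x + 1.
Proof.
  unfold chord_map. assert (Hpi := PI_RGT_0).
  destruct (atan_bound (slope V x)) as [H1 H2].
  assert (- / 2 < atan (slope V x) / PI < / 2); [| lra].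
  split; [apply Rmult_lt_reg_r with PI | apply Rmult_lt_reg_r with PI]; try assumption;
    unfold Rdiv; rewrite Rmult_assoc, Rinv_l; lra.
Qed.

Lemma slope_shift (V : pt2) (x : R) : slope V (x + 1) = slope V x.
Proof.
  pose proof (circ_shift x) as H; unfold circ in H; injection H as Hc Hs.
  unfold slope; now rewrite Hc, Hs.
Qed.

Lemma chord_map_shift (V : pt2) (x : R) : chord_map V (x + 1) = chord_map V x + 1.
Proof. unfold chord_map; rewrite slope_shift; ring. Qed.

Lemma slope_denominator_pos (V : pt2) (x : R) :
  inD V -> 0 < 1 - cos (2 * PI * x) * fst V - sin (2 * PI * x) * snd V.
Proof. intros H; pose proof (lor_circ_pos V x H); vec_unfold; lra. Qed.

Lemma cos_atan_pos (g : R) : 0 < cos (atan g).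
Proof. apply cos_gt_0; pose proof (atan_bound g); lra. Qed.

Lemma sin_atan_eq (g : R) : sin (atan g) = g * cos (atan g).
Proof.
  pose proof (cos_atan_pos g). rewrite <- (tan_atan g) at 2. unfold tan. field; lra.
Qed.

(** The chord from [x] to [y] has length [2 sin (PI (y - x))], and by the inscribed angle theorem it
    makes the angle [PI (chord_map V x - y)] with the direction of [V]. Hence [M] is
    [2 |V - circ x|], where [|V - circ x|] is [dn / cos (atan g)]. *)
Lemma cross_chord_map (V : pt2) (x y : R) : inD V ->
  exists M, 0 < M /\
    cross (circ x) (circ y) V = sin (PI * (y - x)) * M * sin (PI * (chord_map V x - y)).
Proof.
  intros HV. pose proof (slope_denominator_pos V x HV) as Hd.
  assert (Hpi := PI_RGT_0).
  set (g := slope V x). pose proof (cos_atan_pos g) as Hc. pose proof (sin_atan_eq g) as Hs.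
  set (dn := 1 - cos (2 * PI * x) * fst V - sin (2 * PI * x) * snd V) in *.
  exists (2 * dn / cos (atan g)); split.
  { apply Rdiv_lt_0_compat; lra. }
  set (al := PI * (y - x)).
  replace (PI * (chord_map V x - y)) with (PI / 2 - (al + atan g))
    by (unfold chord_map, al; fold g; field; lra).
  rewrite sin_shift, cos_plus, Hs.
  replace (sin al * (2 * dn / cos (atan g)) *
           (cos al * cos (atan g) - sin al * (g * cos (atan g))))
    with (2 * sin al * (dn * cos al - sin al * (g * dn))) by (field; lra).
  replace (g * dn) with (cos (2 * PI * x) * snd V - sin (2 * PI * x) * fst V)
    by (unfold g, slope; fold dn; field; lra).
  unfold cross, circ; simpl.
  replace (2 * PI * y) with (2 * PI * x + 2 * al) by (unfold al; ring).
  rewrite cos_plus, sin_plus, cos_2a, sin_2a.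
  unfold dn. pose proof (sin2_cos2 (2 * PI * x)) as H1; pose proof (sin2_cos2 al) as H2.
  unfold Rsqr in *.
  set (c := cos (2 * PI * x)) in *; set (s := sin (2 * PI * x)) in *.
  set (ca := cos al) in *; set (sa := sin al) in *.
  replace (ca * ca) with (1 - sa * sa) by lra.
  assert (E : s * s = 1 - c * c) by lra.
  ring_simplify. ring_simplify in E. rewrite ?E. ring.
Qed.

(** In the product formula only the last sine can change sign, and its argument lies strictly
    between [-PI] and [PI]. *)
Lemma cross_pos_iff (V : pt2) (x y : R) : inD V -> x < y < x + 1 ->
  0 < cross (circ x) (circ y) V <-> y < chord_map V x.
Proof.
  intros HV Hxy. destruct (cross_chord_map V x y HV) as [M [HM E]].
  assert (Hpi := PI_RGT_0). pose proof (chord_map_bounds V x) as Hb.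
  assert (H1 : 0 < sin (PI * (y - x))) by (apply sin_gt_0; nra).
  assert (H2 : 0 < sin (PI * (y - x)) * M) by now apply Rmult_lt_0_compat.
  rewrite E; split; intros H.
  - apply Rnot_le_lt; intros Hle.
    assert (0 <= sin (PI * (y - chord_map V x))) by (apply sin_ge_0; nra).
    replace (PI * (chord_map V x - y)) with (- (PI * (y - chord_map V x))) in H by ring.
    rewrite sin_neg in H. nra.
  - apply Rmult_lt_0_compat; [assumption |]. apply sin_gt_0; nra.
Qed.

Lemma cross_nonneg_iff (V : pt2) (x y : R) : inD V -> x < y < x + 1 ->
  0 <= cross (circ x) (circ y) V <-> y <= chord_map V x.
Proof.
  intros HV Hxy. destruct (cross_chord_map V x y HV) as [M [HM E]].
  assert (Hpi := PI_RGT_0). pose proof (chord_map_bounds V x) as Hb.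
  assert (H1 : 0 < sin (PI * (y - x))) by (apply sin_gt_0; nra).
  assert (H2 : 0 < sin (PI * (y - x)) * M) by now apply Rmult_lt_0_compat.
  rewrite E; split; intros H.
  - apply Rnot_lt_le; intros Hlt.
    assert (0 < sin (PI * (y - chord_map V x))) by (apply sin_gt_0; nra).
    replace (PI * (chord_map V x - y)) with (- (PI * (y - chord_map V x))) in H by ring.
    rewrite sin_neg in H. nra.
  - apply Rmult_le_pos; [lra |]. apply sin_ge_0; nra.
Qed.

Lemma cross_chord_map_eq0 (V : pt2) (x : R) : inD V ->
  cross (circ x) (circ (chord_map V x)) V = 0.
Proof.
  intros HV. destruct (cross_chord_map V x (chord_map V x) HV) as [M [_ E]].
  rewrite E, Rminus_diag, Rmult_0_r, sin_0; ring.
Qed.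

Lemma chord_map_unique (V : pt2) (x y : R) : inD V -> x < y < x + 1 ->
  cross (circ x) (circ y) V = 0 -> chord_map V x = y.
Proof.
  intros HV Hxy H.
  pose proof (proj1 (cross_nonneg_iff V x y HV Hxy) ltac:(lra)).
  pose proof (proj2 (cross_pos_iff V x y HV Hxy)).
  destruct (Rle_lt_or_eq_dec y (chord_map V x)); [assumption | | congruence].
  assert (0 < cross (circ x) (circ y) V) by auto. lra.
Qed.

Lemma chord_map_involutive (V : pt2) (x : R) : inD V ->
  chord_map V (chord_map V x) = x + 1.
Proof.
  intros HV. pose proof (chord_map_bounds V x).
  apply chord_map_unique; [assumption | lra |].
  rewrite circ_shift. pose proof (cross_chord_map_eq0 V x HV) as H0.
  rewrite cross_det3 in *. rewrite <- Ropp_0, <- H0. vec_ring.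
Qed.

(** The derivative is [(1 - |V|^2) / |V - circ x|^2], the ratio of the distances from [V] to the two
    ends of the chord. *)
Lemma derivable_pt_lim_chord_map (V : pt2) (x : R) : inD V ->
  exists l, 0 < l /\ derivable_pt_lim (chord_map V) x l.
Proof.
  intros HV. pose proof (slope_denominator_pos V x HV) as Hd.
  assert (Hpi := PI_RGT_0).
  set (c := cos (2 * PI * x)) in *; set (s := sin (2 * PI * x)) in *.
  set (dn := 1 - c * fst V - s * snd V) in *. set (nm := c * snd V - s * fst V).
  assert (Hang : derivable_pt_lim (fun x => 2 * PI * x) x (2 * PI)).
  { pattern (2 * PI) at 2; rewrite <- (Rmult_1_r (2 * PI)).
    apply (derivable_pt_lim_scal (fun x => x)), derivable_pt_lim_id. }
  assert (Hcos : derivable_pt_lim (fun x => cos (2 * PI * x)) x (- s * (2 * PI))).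
  { apply (derivable_pt_lim_comp (fun x => 2 * PI * x) cos); [exact Hang |].
    apply derivable_pt_lim_cos. }
  assert (Hsin : derivable_pt_lim (fun x => sin (2 * PI * x)) x (c * (2 * PI))).
  { apply (derivable_pt_lim_comp (fun x => 2 * PI * x) sin); [exact Hang |].
    apply derivable_pt_lim_sin. }
  assert (Hlin : forall f l k, derivable_pt_lim f x l ->
            derivable_pt_lim (fun x => f x * k) x (l * k)).
  { intros f l k Hf. replace (l * k) with (l * k + f x * 0) by ring.
    apply (derivable_pt_lim_mult f (fun _ => k)); [exact Hf | apply derivable_pt_lim_const]. }
  assert (Hslope : derivable_pt_lim (slope V) x
            (((- s * (2 * PI) * snd V - c * (2 * PI) * fst V) * dn
              - (0 - - s * (2 * PI) * fst V - c * (2 * PI) * snd V) * nm) / Rsqr dn)).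
  { apply (derivable_pt_lim_div
             (fun x => cos (2 * PI * x) * snd V - sin (2 * PI * x) * fst V)
             (fun x => 1 - cos (2 * PI * x) * fst V - sin (2 * PI * x) * snd V)).
    - apply (derivable_pt_lim_minus (fun x => cos (2 * PI * x) * snd V)
               (fun x => sin (2 * PI * x) * fst V)); now apply Hlin.
    - apply (derivable_pt_lim_minus (fun x => 1 - cos (2 * PI * x) * fst V)
               (fun x => sin (2 * PI * x) * snd V)); [| now apply Hlin].
      apply (derivable_pt_lim_minus (fun _ => 1) (fun x => cos (2 * PI * x) * fst V));
        [apply derivable_pt_lim_const | now apply Hlin].
    - fold c s dn. lra. }
  set (l0 := _ / Rsqr dn) in Hslope.
  assert (Hat := derivable_pt_lim_comp (slope V) atan x _ _ Hslope
                   (derivable_pt_lim_atan (slope V x))).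
  exists (1 + 0 - (/ (1 + slope V x ^ 2)) * l0 * / PI). split.
  - assert (Hsl : slope V x = nm / dn) by reflexivity.
    assert (Hk : 0 < dn * dn + nm * nm) by nra.
    assert (Hcs : c * c + s * s = 1)
      by (pose proof (sin2_cos2 (2 * PI * x)) as Hsc; unfold Rsqr in Hsc; fold c s in Hsc; lra).
    replace (1 + 0 - (/ (1 + slope V x ^ 2)) * l0 * / PI)
      with ((1 - fst V ^ 2 - snd V ^ 2) / (dn * dn + nm * nm)).
    { apply Rdiv_lt_0_compat; [unfold inD in HV; lra | assumption]. }
    rewrite Hsl; unfold l0, Rsqr.
    apply Rmult_eq_reg_r with (dn * dn + nm * nm); [| lra].
    transitivity (1 - fst V ^ 2 - snd V ^ 2); [field; lra |].
    transitivity (dn * dn + nm * nm + 2 * ((s * snd V + c * fst V) * dn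
       + (s * fst V - c * snd V) * nm)); [| field; repeat split; nra].
    unfold dn, nm.
    transitivity ((c*c+s*s) - (c*c+s*s)*(fst V ^ 2 + snd V ^ 2)
       + (1 - (c*c+s*s)));
      [rewrite Hcs; ring | ring].
  - apply (derivable_pt_lim_minus (fun x => x + / 2) (fun x => atan (slope V x) / PI)).
    + apply (derivable_pt_lim_plus (fun x => x) (fun _ => / 2));
        [apply derivable_pt_lim_id | apply derivable_pt_lim_const].
    + apply (Hlin (fun x => atan (slope V x))). exact Hat.
Qed.

Lemma chord_map_continuity (V : pt2) : inD V -> continuity (chord_map V).
Proof.
  intros HV x. destruct (derivable_pt_lim_chord_map V x HV) as [l [_ Hl]].
  apply derivable_continuous_pt. now exists l.
Qed.

Lemma chord_map_increasing (V : pt2) (x y : R) : inD V ->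
  x < y -> chord_map V x < chord_map V y.
Proof.
  intros HV Hxy.
  assert (pr : derivable (chord_map V)).
  { intros z. apply constructive_indefinite_description.
    destruct (derivable_pt_lim_chord_map V z HV) as [l [_ Hl]]. now exists l. }
  apply (positive_derivative _ pr); [| exact Hxy].
  intros z. destruct (derivable_pt_lim_chord_map V z HV) as [l [Hl0 Hl]].
  rewrite (derive_pt_eq_0 _ _ _ (pr z) Hl). exact Hl0.
Qed.

Lemma chord_map_le_iff (V : pt2) (x y : R) : inD V ->
  chord_map V x <= chord_map V y <-> x <= y.
Proof.
  intros HV; split; intros H.
  - apply Rnot_lt_le; intros Hlt. pose proof (chord_map_increasing V y x HV Hlt); lra.
  - destruct H as [H | ->]; [left; now apply chord_map_increasing | lra].
Qed.

(** Links the angular description of the chord map with the linear one, so that later inequalities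
    between angles become signs of [det3]. *)
Lemma on_ray_chord_map (V : pt2) (x : R) (X : vec) : inD V -> on_ray x X ->
  on_ray (chord_map V x) (point_reflection (hom V) X).
Proof.
  intros HV [k [Hk ->]]. pose proof (slope_denominator_pos V x HV) as Hd.
  assert (Hpi := PI_RGT_0).
  set (g := slope V x). pose proof (cos_atan_pos g) as Hc. pose proof (sin_atan_eq g) as Hs.
  pose proof (sin2_cos2 (atan g)) as H2. pose proof (sin2_cos2 (2 * PI * x)) as H1.
  unfold Rsqr in H1, H2.
  set (c := cos (2 * PI * x)) in *; set (s := sin (2 * PI * x)) in *.
  set (dn := 1 - c * fst V - s * snd V) in *. set (nm := c * snd V - s * fst V).
  assert (Hgd : g * dn = nm) by (unfold g, slope; fold c s dn nm; field; lra).
  set (ca := cos (atan g)) in *.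
  (* The angle [atan g] has adjacent side [dn] and opposite side [nm]. Multiplying by the squared
     hypotenuse makes its double-angle formulas polynomial. *)
  assert (Hca : ca * ca * (dn * dn + nm * nm) = dn * dn).
  { rewrite <- Hgd. rewrite Hs in H2.
    replace (ca * ca * (dn * dn + g * dn * (g * dn)))
      with ((g * ca * (g * ca) + ca * ca) * (dn * dn)) by ring.
    rewrite H2; ring. }
  assert (Hsc : (dn * dn + nm * nm) * (2 * (g * ca) * ca) = 2 * dn * nm).
  { apply Rmult_eq_reg_r with dn; [| lra].
    transitivity (2 * (ca * ca * (dn * dn + nm * nm)) * (g * dn)); [ring |].
    rewrite Hca, Hgd; ring. }
  assert (Hcc : (dn * dn + nm * nm) * (2 * ca * ca - 1) = dn * dn - nm * nm) by lra.
  exists (k * (dn * dn + nm * nm)); split; [apply Rmult_lt_0_compat; [assumption | pose proof (Rle_0_sqr nm) as Hn; unfold Rsqr in Hn; nra] |].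
  unfold circ at 2. unfold chord_map; fold g.
  replace (2 * PI * (x + / 2 - atan g / PI)) with (2 * PI * x + (PI - 2 * atan g)) by (field; lra).
  rewrite cos_plus, sin_plus, Rtrigo_facts.cos_pi_minus, Rtrigo_facts.sin_pi_minus,
    sin_2a, cos_2a_cos, Hs.
  fold c s ca. unfold circ; fold c s.
  (* In the orthonormal frame of the radius and the tangent at [circ x], the point [V] has
     coordinates [1 - dn] and [nm]. *)
  assert (Hv1 : fst V = c * (1 - dn) - s * nm).
  { unfold dn, nm. transitivity ((s * s + c * c) * fst V); [rewrite H1 |]; ring. }
  assert (Hv2 : snd V = s * (1 - dn) + c * nm).
  { unfold dn, nm. transitivity ((s * s + c * c) * snd V); [rewrite H1 |]; ring. }
  assert (Hvv : lor (hom V) (hom V) = 1 - (1 - dn) * (1 - dn) - nm * nm).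
  { vec_unfold. unfold dn, nm.
    transitivity (1 - (s * s + c * c) * (fst V * fst V + snd V * snd V)); [rewrite H1 |]; ring. }
  assert (Hvx : lor (hom V) (vscal k (hom (c, s))) = k * dn)
    by (vec_unfold; unfold dn; ring).
  unfold point_reflection; rewrite Hvv, Hvx.
  unfold vadd, vscal, hom, vx, vy, vz; simpl. rewrite Hv1, Hv2.
  f_equal; [f_equal |].
  - transitivity (k * (c * - ((dn * dn + nm * nm) * (2 * ca * ca - 1))
                       - s * ((dn * dn + nm * nm) * (2 * (g * ca) * ca)))); [| ring].
    rewrite Hsc, Hcc; ring.
  - transitivity (k * (s * - ((dn * dn + nm * nm) * (2 * ca * ca - 1))
                       + c * ((dn * dn + nm * nm) * (2 * (g * ca) * ca)))); [| ring].
    rewrite Hsc, Hcc; ring.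
  - ring.
Qed.

Lemma cross_on_ray (V : pt2) (x y : R) (X Y : vec) : on_ray x X -> on_ray y Y ->
  exists k, 0 < k /\ det3 X Y (hom V) = k * cross (circ x) (circ y) V.
Proof.
  intros [k [Hk ->]] [k' [Hk' ->]]. exists (k * k'); split; [nra |].
  rewrite cross_det3. vec_ring.
Qed.

Lemma det3_nonneg_on_ray (V : pt2) (x y : R) (X Y : vec) : on_ray x X -> on_ray y Y ->
  0 <= det3 X Y (hom V) <-> 0 <= cross (circ x) (circ y) V.
Proof.
  intros HX HY. destruct (cross_on_ray V x y X Y HX HY) as [k [Hk ->]].
  split; intros H; [apply Rmult_le_reg_l with k; lra | apply Rmult_le_pos; lra].
Qed.

Lemma det3_pos_on_ray (V : pt2) (x y : R) (X Y : vec) : on_ray x X -> on_ray y Y ->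
  0 < det3 X Y (hom V) <-> 0 < cross (circ x) (circ y) V.
Proof.
  intros HX HY. destruct (cross_on_ray V x y X Y HX HY) as [k [Hk ->]].
  split; intros H; [apply Rmult_lt_reg_l with k; lra | apply Rmult_lt_0_compat; lra].
Qed.

(** * Lift of psi and rotation number *)

Lemma IZR_not_between_0_1 (k : Z) : ~ (0 < IZR k < 1).
Proof. intros [H1 H2]. apply lt_IZR in H1, H2. lia. Qed.

Lemma proj_unique (x y : R) (k : Z) : 0 <= y < 1 -> x = y + IZR k -> proj x = y.
Proof.
  intros Hy Hx. unfold proj, frac_part.
  rewrite <- (Int_part_spec x k); lra.
Qed.

Lemma proj_decomposition (x : R) : 0 <= proj x < 1 /\ x = proj x + IZR (Int_part x).
Proof. pose proof (base_fp x). unfold proj, frac_part in *. lra. Qed.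

Lemma proj_eq_IZR (x y : R) : proj x = proj y -> exists k, x - y = IZR k.
Proof.
  intros H. exists (Int_part x - Int_part y)%Z. rewrite minus_IZR.
  pose proof (proj_decomposition x). pose proof (proj_decomposition y). lra.
Qed.

Lemma circ_shift_nat (x : R) (n : nat) : circ (x + INR n) = circ x.
Proof.
  induction n as [| n IH]; [simpl; now rewrite Rplus_0_r |].
  rewrite S_INR, <- Rplus_assoc, circ_shift. exact IH.
Qed.

Lemma circ_shift_IZR (x : R) (k : Z) : circ (x + IZR k) = circ x.
Proof.
  destruct (Z.le_gt_cases 0 k) as [Hk | Hk].
  - rewrite <- (Z2Nat.id k), <- INR_IZR_INZ by assumption. apply circ_shift_nat.
  - rewrite <- (circ_shift_nat (x + IZR k) (Z.to_nat (- k))).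
    rewrite INR_IZR_INZ, Z2Nat.id by lia. f_equal. rewrite opp_IZR. ring.
Qed.

Lemma circ_proj (x : R) : circ (proj x) = circ x.
Proof.
  destruct (proj_decomposition x) as [_ H]. rewrite H at 2. now rewrite circ_shift_IZR.
Qed.

(** * The minimum of three chord maps as a lift of [psi] *)

Definition triangle_map (P Q S : pt2) (x : R) : R :=
  Rmin (Rmin (chord_map P x) (chord_map Q x)) (chord_map S x).

Lemma triangle_map_glb (P Q S : pt2) (x y : R) :
  y <= triangle_map P Q S x <->
  y <= chord_map P x /\ y <= chord_map Q x /\ y <= chord_map S x.
Proof.
  unfold triangle_map. split.
  - intros H. pose proof (Rmin_l (Rmin (chord_map P x) (chord_map Q x)) (chord_map S x)).
    pose proof (Rmin_r (Rmin (chord_map P x) (chord_map Q x)) (chord_map S x)).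
    pose proof (Rmin_l (chord_map P x) (chord_map Q x)).
    pose proof (Rmin_r (chord_map P x) (chord_map Q x)). lra.
  - intros [H1 [H2 H3]]. repeat apply Rmin_glb; assumption.
Qed.

Lemma triangle_map_cases (P Q S : pt2) (x : R) :
  exists V, (V = P \/ V = Q \/ V = S) /\ triangle_map P Q S x = chord_map V x.
Proof.
  unfold triangle_map, Rmin. repeat destruct (Rle_dec _ _); eauto.
Qed.

Lemma triangle_map_bounds (P Q S : pt2) (x : R) : x < triangle_map P Q S x < x + 1.
Proof.
  destruct (triangle_map_cases P Q S x) as [V [_ ->]]. apply chord_map_bounds.
Qed.

Lemma triangle_map_shift (P Q S : pt2) (x : R) :
  triangle_map P Q S (x + 1) = triangle_map P Q S x + 1.
Proof.
  unfold triangle_map, Rmin. rewrite !chord_map_shift.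
  repeat destruct (Rle_dec _ _); lra.
Qed.

Lemma triangle_map_le (P Q S : pt2) (x y : R) : inD P -> inD Q -> inD S ->
  x <= y -> triangle_map P Q S x <= triangle_map P Q S y.
Proof.
  intros HP HQ HS Hxy. apply triangle_map_glb.
  destruct (proj1 (triangle_map_glb P Q S x _) (Rle_refl _)) as [H1 [H2 H3]].
  repeat split;
    [apply Rle_trans with (chord_map P x) | apply Rle_trans with (chord_map Q x)
    | apply Rle_trans with (chord_map S x)]; try assumption; now apply chord_map_le_iff.
Qed.

Lemma continuity_Rmin (f g : R -> R) :
  continuity f -> continuity g -> continuity (fun x => Rmin (f x) (g x)).
Proof.
  intros Hf Hg x.
  apply continuity_pt_locally_ext with (f := fun x => (f x + g x - Rabs (f x - g x)) * / 2) (a := 1);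
    [lra | |].
  - intros y _. unfold Rmin, Rabs. destruct (Rle_dec _ _), (Rcase_abs _); lra.
  - apply (continuity_pt_mult (fun x => f x + g x - Rabs (f x - g x)) (fun _ => / 2));
      [| apply continuity_pt_const; now intros ? ?].
    apply (continuity_pt_minus (fun x => f x + g x) (fun x => Rabs (f x - g x))).
    + now apply continuity_pt_plus.
    + apply (continuity_pt_comp (fun x => f x - g x) Rabs);
        [now apply continuity_pt_minus | apply Rcontinuity_abs].
Qed.

Lemma triangle_map_continuity (P Q S : pt2) : inD P -> inD Q -> inD S ->
  continuity (triangle_map P Q S).
Proof.
  intros HP HQ HS. apply continuity_Rmin; [apply continuity_Rmin |];
    now apply chord_map_continuity.
Qed.

Lemma filled_triangle_vertex (P Q S V : pt2) :
  V = P \/ V = Q \/ V = S -> filled_triangle P Q S V.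
Proof.
  intros [-> | [-> | ->]]; [exists 1, 0, 0 | exists 0, 1, 0 | exists 0, 0, 1];
    repeat split; try lra; ring.
Qed.

Lemma cross_filled_triangle (P Q S v w X : pt2) : filled_triangle P Q S X ->
  exists a b c, 0 <= a /\ 0 <= b /\ 0 <= c /\ a + b + c = 1 /\
    cross v w X = a * cross v w P + b * cross v w Q + c * cross v w S.
Proof.
  intros [a [b [c [Ha [Hb [Hc [H1 [Hx Hy]]]]]]]]. exists a, b, c.
  repeat split; try assumption. unfold cross. rewrite Hx, Hy.
  replace c with (1 - a - b) by lra. ring.
Qed.

(** The vertex attaining the minimum lies on the chord. The other vertices lie weakly to its left,
    and so does the triangle, since [cross] is affine in its last argument. *)
Lemma psi_spec_triangle_map (P Q S : pt2) (x : R) : inD P -> inD Q -> inD S ->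
  psi_spec (filled_triangle P Q S) (proj x) (proj (triangle_map P Q S x)).
Proof.
  intros HP HQ HS. pose proof (triangle_map_bounds P Q S x) as Hb.
  destruct (proj1 (triangle_map_glb P Q S x _) (Rle_refl _)) as [H1 [H2 H3]].
  unfold psi_spec. rewrite !circ_proj. split; [| split; [| split]].
  - apply proj_decomposition.
  - intros H. destruct (proj_eq_IZR _ _ H) as [k Hk].
    apply (IZR_not_between_0_1 k). lra.
  - destruct (triangle_map_cases P Q S x) as [V [HV E]].
    exists V. split; [now apply filled_triangle_vertex |].
    rewrite E. apply cross_chord_map_eq0.
    destruct HV as [-> | [-> | ->]]; assumption.
  - intros X HX.
    destruct (cross_filled_triangle P Q S (circ x) (circ (triangle_map P Q S x)) X HX)
      as [a [b [c [Ha [Hb' [Hc [_ ->]]]]]]].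
    apply cross_nonneg_iff in H1, H2, H3; try assumption.
    pose proof (Rmult_le_pos _ _ Ha H1). pose proof (Rmult_le_pos _ _ Hb' H2).
    pose proof (Rmult_le_pos _ _ Hc H3). lra.
Qed.

(** An endpoint beyond the minimum would leave a vertex on the right; one before it would put all
    vertices strictly to the left, so that the chord would miss the triangle. *)
Lemma psi_spec_unique (P Q S : pt2) (x w : R) : inD P -> inD Q -> inD S ->
  psi_spec (filled_triangle P Q S) (proj x) w -> w = proj (triangle_map P Q S x).
Proof.
  intros HP HQ HS [Hw [Hwv [[X [HX HX0]] Hleft]]].
  destruct (proj_decomposition x) as [Hv Hx].
  (* The representative of [w] in the turn after [x]: one more turn is added when [w] precedes
     [proj x]. *)
  assert (Hy : exists y k, x < y < x + 1 /\ y = w + IZR k).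
  { destruct (Rlt_le_dec (proj x) w).
    - exists (w + IZR (Int_part x)), (Int_part x). lra.
    - exists (w + IZR (Int_part x + 1)), (Int_part x + 1)%Z. rewrite plus_IZR. lra. }
  destruct Hy as [y [k [Hxy Hyw]]].
  assert (Hcw : circ w = circ y) by now rewrite Hyw, circ_shift_IZR.
  rewrite circ_proj, Hcw in *.
  symmetry. apply proj_unique with k; [assumption |]. rewrite <- Hyw.
  assert (Hle : y <= triangle_map P Q S x).
  { apply triangle_map_glb; repeat split; apply cross_nonneg_iff; try assumption;
      apply Hleft, filled_triangle_vertex; auto. }
  destruct Hle as [Hlt | Heq]; [exfalso | congruence].
  destruct (proj1 (triangle_map_glb P Q S x _) (Rle_refl _)) as [H1 [H2 H3]].
  assert (HP' : 0 < cross (circ x) (circ y) P) by (apply cross_pos_iff; lra || assumption).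
  assert (HQ' : 0 < cross (circ x) (circ y) Q) by (apply cross_pos_iff; lra || assumption).
  assert (HS' : 0 < cross (circ x) (circ y) S) by (apply cross_pos_iff; lra || assumption).
  destruct (cross_filled_triangle P Q S (circ x) (circ y) X HX)
    as [a [b [c [Ha [Hb' [Hc [Habc E]]]]]]].
  rewrite HX0 in E.
  pose proof (Rmult_le_pos _ _ Ha (Rlt_le _ _ HP')).
  pose proof (Rmult_le_pos _ _ Hb' (Rlt_le _ _ HQ')).
  pose proof (Rmult_le_pos _ _ Hc (Rlt_le _ _ HS')).
  assert (a = 0) by nra. assert (b = 0) by nra. assert (c = 0) by nra. lra.
Qed.

Lemma triangle_map_is_lift (P Q S : pt2) : inD P -> inD Q -> inD S ->
  is_lift (psi (filled_triangle P Q S)) (triangle_map P Q S).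
Proof.
  intros HP HQ HS. split; [now apply triangle_map_continuity | split].
  - intros x. symmetry. apply psi_spec_unique; try assumption.
    unfold psi. apply epsilon_spec.
    exists (proj (triangle_map P Q S x)). now apply psi_spec_triangle_map.
  - pose proof (triangle_map_bounds P Q S 0). lra.
Qed.

(** A nonzero value would force the value [1/2] or [-1/2] by the intermediate value theorem; the
    sign [s] treats both at once. *)
Lemma continuous_integer_valued_zero (H : R -> R) :
  continuity H -> (forall x, exists k, H x = IZR k) -> H 0 = 0 -> forall x, H x = 0.
Proof.
  intros Hc Hint H0.
  assert (Hhalf : forall s z, (s = 1 \/ s = -1) -> s * H z - / 2 <> 0).
  { intros s z Hs E. destruct (Hint z) as [k Hk]. rewrite Hk in E.
    destruct Hs as [-> | ->].
    - apply (IZR_not_between_0_1 k). lra.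
    - apply (IZR_not_between_0_1 (- k)). rewrite opp_IZR. lra. }
  assert (Hle : forall s z, (s = 1 \/ s = -1) -> s * H z <= 0).
  { intros s z Hs. apply Rnot_lt_le. intros Hpos.
    assert (Hge : / 2 <= s * H z).
    { destruct (Hint z) as [k Hk]. rewrite Hk in *. apply Rnot_lt_le; intros Hlt.
      destruct Hs as [-> | ->].
      - apply (IZR_not_between_0_1 k). lra.
      - apply (IZR_not_between_0_1 (- k)). rewrite opp_IZR. lra. }
    assert (Hc' : continuity (fun x => s * H x - / 2)).
    { apply (continuity_minus (fun x => s * H x) (fun _ => / 2));
        [now apply (continuity_scal H) | apply continuity_const; now intros ? ?]. }
    destruct (Rle_dec 0 z) as [Hz | Hz].
    - destruct (IVT_cor _ 0 z Hc' Hz) as [t [_ Ht]]; [rewrite H0; nra |].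
      exact (Hhalf s t Hs Ht).
    - destruct (IVT_cor _ z 0 Hc' ltac:(lra)) as [t [_ Ht]]; [rewrite H0; nra |].
      exact (Hhalf s t Hs Ht). }
  intros x. pose proof (Hle 1 x (or_introl eq_refl)).
  pose proof (Hle (-1) x (or_intror eq_refl)). lra.
Qed.

(** The difference of two lifts is continuous and integer valued, and it vanishes at 0 by the
    normalization [0 <= F 0 < 1]. *)
Lemma lift_unique (f F G : R -> R) : is_lift f F -> is_lift f G -> forall x, F x = G x.
Proof.
  intros [HFc [HF HF0]] [HGc [HG HG0]].
  assert (Hid : forall y, 0 <= y < 1 -> proj y = y)
    by (intros y Hy; apply proj_unique with 0%Z; simpl; lra).
  assert (H0 : F 0 = G 0).
  { rewrite <- (Hid (F 0)), <- (Hid (G 0)), HF, HG by assumption. reflexivity. }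
  intros x. apply Rminus_diag_uniq.
  apply (continuous_integer_valued_zero (fun x => F x - G x)).
  - now apply continuity_minus.
  - intros y. apply proj_eq_IZR. now rewrite HF, HG.
  - lra.
Qed.

Lemma iter_ext (F G : R -> R) (n : nat) (x : R) :
  (forall y, F y = G y) -> Nat.iter n F x = Nat.iter n G x.
Proof. intros H; induction n as [| n IH]; simpl; [reflexivity | now rewrite IH, H]. Qed.

(** * Rotation number from one upper and one lower orbit estimate *)

Section RotationNumber.

Variable F : R -> R.
Hypothesis F_le : forall x y, x <= y -> F x <= F y.
Hypothesis F_shift : forall x, F (x + 1) = F x + 1.
Hypothesis F_bounds : forall x, x <= F x <= x + 1.

Lemma iter_le (n : nat) (x y : R) : x <= y -> Nat.iter n F x <= Nat.iter n F y.
Proof. intros H; induction n; simpl; auto. Qed.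

Lemma shift_nat (k : nat) (x : R) : F (x + INR k) = F x + INR k.
Proof.
  induction k as [| k IH]; [simpl; now rewrite !Rplus_0_r |].
  rewrite S_INR, <- !Rplus_assoc, F_shift, IH. ring.
Qed.

Lemma iter_shift_nat (n k : nat) (x : R) : Nat.iter n F (x + INR k) = Nat.iter n F x + INR k.
Proof. induction n as [| n IH]; simpl; [reflexivity | now rewrite IH, shift_nat]. Qed.

Lemma iter_bounds (n : nat) (x : R) : x <= Nat.iter n F x <= x + INR n.
Proof.
  induction n as [| n IH]; [simpl; lra |].
  rewrite S_INR; simpl. pose proof (F_bounds (Nat.iter n F x)). lra.
Qed.

Lemma iter_mul_le (q p k : nat) (a : R) :
  Nat.iter q F a <= a + INR p -> Nat.iter (k * q) F a <= a + INR (k * p).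
Proof.
  intros H; induction k as [| k IH]; [simpl; lra |].
  simpl. rewrite Nat.iter_add. eapply Rle_trans; [apply iter_le, IH |].
  rewrite iter_shift_nat, plus_INR. lra.
Qed.

Lemma iter_mul_ge (q p k : nat) (a : R) :
  a + INR p <= Nat.iter q F a -> a + INR (k * p) <= Nat.iter (k * q) F a.
Proof.
  intros H; induction k as [| k IH]; [simpl; lra |].
  simpl. rewrite Nat.iter_add. eapply Rle_trans; [| apply iter_le, IH].
  rewrite iter_shift_nat, plus_INR. lra.
Qed.

Lemma nat_above (x : R) : exists n, x <= INR n.
Proof.
  destruct (INR_unbounded x) as [n Hn]. exists n. lra.
Qed.

(** Monotonicity compares the orbit of [x] with those of integer translates of [a] and [b]. Whole
    blocks of [q] steps are controlled by the two estimates, and the fewer than [q] remaining steps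
    move by at most [q]. *)
Lemma iter_deviation_bounded (q p : nat) (a b x : R) : (0 < q)%nat ->
  Nat.iter q F a <= a + INR p -> b + INR p <= Nat.iter q F b ->
  exists C, forall n, Rabs (Nat.iter n F x - x - INR n * (INR p / INR q)) <= C.
Proof.
  intros Hq Ha Hb.
  destruct (nat_above (x - a)) as [m Hm]. destruct (nat_above (b - x)) as [m' Hm'].
  exists (Rabs (a - x) + Rabs (b - x) + INR m + INR m' + INR q + INR p). intros n.
  assert (Hq0 : 0 < INR q) by (apply (lt_INR 0); assumption).
  pose proof (pos_INR p). pose proof (pos_INR m). pose proof (pos_INR m').
  set (k := (n / q)%nat). set (r := (n mod q)%nat).
  assert (Hn : n = (r + k * q)%nat)
    by (unfold r, k; pose proof (Nat.div_mod_eq n q); lia).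
  assert (Hr : (r < q)%nat) by (apply Nat.mod_upper_bound; lia).
  assert (Hr' : INR r <= INR q) by (apply le_INR; lia).
  pose proof (pos_INR r).
  assert (HnR : INR n * (INR p / INR q) = INR (k * p) + INR r / INR q * INR p).
  { rewrite Hn, plus_INR, !mult_INR. field. lra. }
  assert (Hrq : 0 <= INR r / INR q <= 1).
  { split; [apply Rmult_le_pos; [assumption | left; now apply Rinv_0_lt_compat] |].
    apply Rmult_le_reg_r with (INR q); [assumption |].
    unfold Rdiv; rewrite Rmult_assoc, Rinv_l; lra. }
  assert (Hrqp : 0 <= INR r / INR q * INR p <= INR p) by nra.
  rewrite HnR.
  assert (Hup : Nat.iter n F x <= a + INR m + INR q + INR (k * p)).
  { apply Rle_trans with (Nat.iter n F (a + INR m)); [apply iter_le; lra |].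
    rewrite iter_shift_nat, Hn, Nat.iter_add.
    pose proof (iter_bounds r (Nat.iter (k * q) F a)).
    pose proof (iter_mul_le q p k a Ha). lra. }
  assert (Hlo : b - INR m' + INR (k * p) <= Nat.iter n F x).
  { assert (Nat.iter n F b <= Nat.iter n F x + INR m')
      by (rewrite <- iter_shift_nat; apply iter_le; lra).
    assert (Hnb : Nat.iter n F b = Nat.iter r F (Nat.iter (k * q) F b))
      by now rewrite <- Nat.iter_add, <- Hn.
    pose proof (iter_bounds r (Nat.iter (k * q) F b)).
    pose proof (iter_mul_ge q p k b Hb). lra. }
  pose proof (Rle_abs (a - x)). pose proof (Rle_abs (- (b - x))) as Hbx.
  rewrite Rabs_Ropp in Hbx. pose proof (Rabs_pos (a - x)). pose proof (Rabs_pos (b - x)).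
  apply Rabs_le. lra.
Qed.

Lemma rotation_number_of_bounds (q p : nat) (a b : R) : (0 < q)%nat ->
  Nat.iter q F a <= a + INR p -> b + INR p <= Nat.iter q F b ->
  forall x, Un_cv (fun n => (Nat.iter n F x - x) / INR n) (INR p / INR q).
Proof.
  intros Hq Ha Hb x eps Heps.
  destruct (iter_deviation_bounded q p a b x Hq Ha Hb) as [C HC].
  destruct (nat_above (C / eps)) as [N HN]. exists (S N). intros n Hn.
  assert (HnN : INR N + 1 <= INR n) by (rewrite <- S_INR; apply le_INR; lia).
  pose proof (pos_INR N).
  unfold Rdist.
  replace ((Nat.iter n F x - x) / INR n - INR p / INR q)
    with ((Nat.iter n F x - x - INR n * (INR p / INR q)) / INR n)
    by (field; split; [apply not_0_INR; lia | lra]).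
  unfold Rdiv at 1. rewrite Rabs_mult, (Rabs_pos_eq (/ INR n))
    by (left; apply Rinv_0_lt_compat; lra).
  apply Rmult_lt_reg_r with (INR n); [lra |].
  rewrite Rmult_assoc, Rinv_l, Rmult_1_r by lra.
  apply Rle_lt_trans with C; [apply HC |].
  assert (C <= INR N * eps).
  { apply Rmult_le_reg_r with (/ eps); [now apply Rinv_0_lt_compat |].
    rewrite Rmult_assoc, Rinv_r by lra. unfold Rdiv in HN. lra. }
  nra.
Qed.

End RotationNumber.

Lemma rotation_number_triangle (P Q S : pt2) (q p : nat) (a b : R) :
  inD P -> inD Q -> inD S -> (0 < q)%nat ->
  Nat.iter q (triangle_map P Q S) a <= a + INR p ->
  b + INR p <= Nat.iter q (triangle_map P Q S) b ->
  rotation_number_is (psi (filled_triangle P Q S)) (INR p / INR q).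
Proof.
  intros HP HQ HS Hq Ha Hb. pose proof (triangle_map_is_lift P Q S HP HQ HS) as HT.
  split; [now exists (triangle_map P Q S) |].
  intros F HF x eps Heps.
  assert (Hcv : Un_cv (fun n => (Nat.iter n (triangle_map P Q S) x - x) / INR n) (INR p / INR q)).
  { apply rotation_number_of_bounds with a b; try assumption.
    - intros; now apply triangle_map_le.
    - intros; apply triangle_map_shift.
    - intros y; pose proof (triangle_map_bounds P Q S y); lra. }
  destruct (Hcv eps Heps) as [N HN]. exists N. intros n Hn.
  rewrite (iter_ext F (triangle_map P Q S)); [now apply HN |].
  now apply (lift_unique (psi (filled_triangle P Q S))).
Qed.

(** * Upper bound *)

(** Minus the Gram determinant. For two points of the disk at distance [d] it is
    [lor X X * lor Y Y * sinh d ^ 2]. *)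
Definition gram2 (X Y : vec) : R := lor X Y ^ 2 - lor X X * lor Y Y.

Lemma gram2_pos (P Q : pt2) : inD P -> P <> Q -> 0 < gram2 (hom P) (hom Q).
Proof.
  destruct P as [p1 p2], Q as [q1 q2]; unfold inD; simpl; intros HP HPQ.
  unfold gram2; vec_unfold.
  set (v1 := q1 - p1). set (v2 := q2 - p2).
  assert (Hv : 0 < v1 ^ 2 + v2 ^ 2).
  { destruct (Req_dec v1 0) as [E1 | E1]; [destruct (Req_dec v2 0) as [E2 | E2] |].
    - exfalso; apply HPQ. unfold v1, v2 in *. f_equal; lra.
    - pose proof (Rsqr_pos_lt v2 E2) as H; unfold Rsqr in H. pose proof (pow2_ge_0 v1). lra.
    - pose proof (Rsqr_pos_lt v1 E1) as H; unfold Rsqr in H. pose proof (pow2_ge_0 v2). lra. }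
  replace q1 with (p1 + v1) by (unfold v1; ring).
  replace q2 with (p2 + v2) by (unfold v2; ring).
  (* With [v = Q - P], this is [(1 - |P|^2) |v|^2] plus the square of the scalar product of [P] and
     [v]. *)
  match goal with |- 0 < ?g =>
    replace g with ((1 - p1 ^ 2 - p2 ^ 2) * (v1 ^ 2 + v2 ^ 2) + (p1 * v1 + p2 * v2) ^ 2) by ring
  end.
  pose proof (pow2_ge_0 (p1 * v1 + p2 * v2)).
  assert (0 < (1 - p1 ^ 2 - p2 ^ 2) * (v1 ^ 2 + v2 ^ 2)) by (apply Rmult_lt_0_compat; lra).
  lra.
Qed.

(** The 3 by 3 Gram determinant is [det3 X Y Z ^ 2], because the form has determinant 1. For points
    of the disk the right side is [gram2 X Y * lor Z Z * cosh h ^ 2], with [h] the distance from [Z]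
    to the line [XY]. *)
Lemma gram3 (X Y Z : vec) :
  2 * lor X Z * lor Y Z * lor X Y - lor X Z ^ 2 * lor Y Y - lor Y Z ^ 2 * lor X X
  = det3 X Y Z ^ 2 + gram2 X Y * lor Z Z.
Proof. unfold gram2; vec_ring. Qed.

Lemma lor_point_reflection (X V Y : vec) :
  lor X (point_reflection V Y) = 2 * lor V Y * lor X V - lor V V * lor X Y.
Proof. vec_ring. Qed.

Lemma det3_point_reflection (X V Y Z : vec) :
  det3 X (point_reflection V Y) Z = 2 * lor V Y * det3 X V Z - lor V V * det3 X Y Z.
Proof.
  unfold point_reflection. generalize (lor V Y) (lor V V). vec_ring.
Qed.

(** Gives the side of the chord from [Q P m] to [P Q m] on which [S] lies. The second term in the
    bracket contains the expression evaluated by [gram3]. *)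
Lemma det3_double_reflection (P Q S m : vec) :
  det3 (point_reflection Q (point_reflection P m)) (point_reflection P (point_reflection Q m)) S
  = 4 * lor P Q *
    (lor P P * lor Q Q * (lor Q m * det3 m P S - lor P m * det3 m Q S)
     - 2 * (2 * lor P m * lor Q m * lor P Q - lor P m ^ 2 * lor Q Q - lor Q m ^ 2 * lor P P)
       * det3 P Q S).
Proof.
  unfold point_reflection at 1 3. rewrite !lor_point_reflection.
  unfold point_reflection. rewrite (lor_sym Q P).
  generalize (lor P m) (lor Q m) (lor P Q) (lor P P) (lor Q Q).
  vec_ring.
Qed.

Lemma lcross_moment (P Q S : vec) :
  lor Q S * det3 (lcross P Q) P S - lor P S * det3 (lcross P Q) Q S
  = det3 P Q S ^ 2 + gram2 P Q * lor S S.
Proof. unfold gram2; vec_ring. Qed.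

(** By Cauchy-Schwarz, the planar part of the product is at most [|vz X|] in absolute value, so a
    nonpositive [vz X] could not give a positive product. *)
Lemma null_vector_future (V : pt2) (X : vec) : inD V ->
  lor X X = 0 -> 0 < lor (hom V) X -> 0 < vz X.
Proof.
  destruct V as [v1 v2], X as [[x1 x2] x3]; unfold inD; vec_unfold; intros HV H0 H.
  apply Rnot_le_lt; intros Hle.
  assert (Hcs : (v1 * x1 + v2 * x2) ^ 2 <= x3 ^ 2).
  { pose proof (pow2_ge_0 (v1 * x2 - v2 * x1)).
    replace (x3 ^ 2) with (x1 * x1 + x2 * x2) by lra.
    apply Rle_trans with ((v1 ^ 2 + v2 ^ 2) * (x1 * x1 + x2 * x2)); [nra |].
    rewrite <- (Rmult_1_l (x1 * x1 + x2 * x2)) at 2.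
    apply Rmult_le_compat_r; nra. }
  nra.
Qed.

(* Chords joining a point to its image under a translation along [PQ] envelop an
   equidistant curve of [PQ]; [t] is the end of the perpendicular from the line
   [PQ] through [S], where the chord from [Q P t] to [P Q t] is closest to [S]. *)
Lemma exists_backward_point (P Q S : pt2) : inD P -> inD Q -> inD S ->
  let p := hom P in let q := hom Q in let s := hom S in
  0 < det3 p q s ->
  lor p p ^ 2 * lor q q ^ 2 * lor s s <= 4 * det3 p q s ^ 2 * lor p q ^ 2 ->
  exists t, chord_map S (chord_map Q (chord_map P t)) <= chord_map P (chord_map Q t).
Proof.
  intros HP HQ HS p q s HD Hhyp.
  assert (HA : 0 < lor p p) by now apply lor_self_pos.
  assert (HC : 0 < lor q q) by now apply lor_self_pos.
  assert (Hr : 0 < lor s s) by now apply lor_self_pos.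
  assert (Hb : 0 < lor p q) by now apply lor_pos.
  assert (Hps : 0 < lor p s) by now apply lor_pos.
  assert (HG : 0 < gram2 p q).
  { apply gram2_pos; [assumption |]. intros ->. unfold p, q in HD.
    replace (det3 (hom Q) (hom Q) s) with 0 in HD by vec_ring. lra. }
  set (D := det3 p q s) in *. set (G := gram2 p q) in *. set (rho := lor s s) in *.
  set (E := D ^ 2 + G * rho).
  assert (HE : 0 < E) by (unfold E; pose proof (pow2_ge_0 D); nra).
  set (se := sqrt E).
  assert (Hse : se ^ 2 = E) by (apply pow2_sqrt; lra).
  assert (Hse0 : 0 < se) by now apply sqrt_lt_R0.
  assert (HseD : D < se) by (apply Rnot_le_lt; intros Hle; unfold E in *; nra).
  (* The positive root of [G tau^2 + 2 D tau - rho = 0]. It makes [s + tau n] null, where [n] is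
     Lorentz orthogonal to [p] and [q]: this is the end of the perpendicular on the side of [S]. *)
  set (tau := (se - D) / G).
  assert (HtG : tau * G = se - D) by (unfold tau; field; lra).
  assert (Htau : 0 < tau) by (apply Rdiv_lt_0_compat; lra).
  assert (Hquad : rho - 2 * tau * D - tau ^ 2 * G = 0).
  { apply Rmult_eq_reg_r with G; [| lra].
    replace ((rho - 2 * tau * D - tau ^ 2 * G) * G)
      with (G * rho - 2 * (tau * G) * D - (tau * G) ^ 2) by ring.
    rewrite HtG. unfold E in Hse. lra. }
  set (n := lcross p q). set (m := vadd s (vscal tau n)).
  assert (Hm0 : lor m m = 0).
  { rewrite <- Hquad. unfold m, n, G, rho, D, gram2. vec_ring. }
  assert (Hpm : lor p m = lor p s) by (unfold m, n; vec_ring).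
  assert (Hqm : lor q m = lor q s) by (unfold m, n; vec_ring).
  assert (Hsm : lor s m = rho - tau * D) by (unfold m, n, rho, D; vec_ring).
  assert (Hmz : 0 < vz m).
  { apply (null_vector_future S); [assumption | assumption |]. fold s.
    rewrite Hsm. pose proof (pow2_ge_0 tau). nra. }
  destruct (null_vector_on_ray m Hm0 Hmz) as [t Ht].
  exists t.
  assert (HPt := on_ray_chord_map P t m HP Ht).
  assert (HQt := on_ray_chord_map Q t m HQ Ht).
  assert (Hu := on_ray_chord_map Q _ _ HQ HPt).
  assert (Hw := on_ray_chord_map P _ _ HP HQt).
  fold p in HPt, Hu, Hw. fold q in HQt, Hu, Hw.
  assert (Hlt : chord_map P t < chord_map Q t).
  { apply cross_pos_iff; [assumption | apply chord_map_bounds |].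
    apply (det3_pos_on_ray Q t _ m _ Ht HPt).
    rewrite det3_point_reflection, Hpm.
    replace (det3 m m (hom Q)) with 0 by vec_ring.
    replace (det3 m p (hom Q)) with (D + tau * G)
      by (unfold m, n, D, G, gram2; fold q; vec_ring).
    nra. }
  assert (Hu1 : chord_map Q (chord_map P t) < t + 1).
  { rewrite <- (chord_map_involutive Q t HQ). now apply chord_map_increasing. }
  assert (Hw1 : t + 1 < chord_map P (chord_map Q t)).
  { rewrite <- (chord_map_involutive P t HP). now apply chord_map_increasing. }
  set (u := chord_map Q (chord_map P t)) in *. set (w := chord_map P (chord_map Q t)) in *.
  (* If [w] is at least one turn past [u], the claim follows from [chord_map S u < u + 1]; otherwise
     the sign test for the chord from [u] to [w] applies. *)
  destruct (Rle_lt_dec (u + 1) w) as [Hfar | Hnear].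
  { pose proof (chord_map_bounds S u). lra. }
  apply Rnot_lt_le. intros Hcon.
  apply cross_pos_iff in Hcon; [| assumption | lra].
  apply (det3_pos_on_ray S u w _ _ Hu Hw) in Hcon. revert Hcon.
  apply Rle_not_lt. fold s.
  rewrite det3_double_reflection, Hpm, Hqm, gram3. fold D G rho E.
  (* The component of [m] along [s] contributes nothing, which leaves [tau] times the moment of the
     normal [n]. *)
  assert (Hmom : lor q s * det3 m p s - lor p s * det3 m q s = tau * E).
  { unfold E, D, G, rho. rewrite <- lcross_moment. fold n. unfold m.
    generalize n. intros n0. generalize (lor q s) (lor p s). vec_ring. }
  rewrite Hmom.
  (* Since [tau G = se - D], this reads [k se <= D (2 G + k)]. Squaring and cancelling [G] gives
     exactly the hypothesis, with [lor p q ^ 2 = G + k]. *)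
  assert (Hkey : lor p p * lor q q * tau <= 2 * D).
  { assert (Hb2 : lor p q ^ 2 = G + lor p p * lor q q) by (unfold G, gram2; ring).
    set (k := lor p p * lor q q) in *.
    assert (Hk : 0 < k) by now apply Rmult_lt_0_compat.
    assert (Hhyp' : k ^ 2 * rho <= 4 * D ^ 2 * (G + k))
      by (rewrite <- Hb2; unfold k; nra).
    apply Rmult_le_reg_r with G; [assumption |].
    rewrite Rmult_assoc, HtG.
    assert (k * se <= D * (2 * G + k)); [| nra].
    apply Rsqr_incr_0_var; [| nra]. unfold Rsqr.
    replace (k * se * (k * se)) with (k ^ 2 * se ^ 2) by ring. rewrite Hse. unfold E.
    assert (0 <= G * (4 * D ^ 2 * (G + k) - k ^ 2 * rho)) by (apply Rmult_le_pos; lra).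
    lra. }
  assert (0 <= 4 * lor p q * E * (2 * D - lor p p * lor q q * tau)).
  { repeat apply Rmult_le_pos; lra. }
  lra.
Qed.

(** From [w = P Q t], bounding [F] by the chord maps of [P], [Q], [P], [Q], [S] in turn leads to
    [Q t + 1], [t + 2], [P t + 2], [Q P t + 2] and [S Q P t + 2], which is at most [w + 2]. The last
    hypothesis says [sinh h * sinh (2 d) >= 1], with [d = |PQ|] and [h] the altitude from [S]. *)
Lemma exists_iter5_le (P Q S : pt2) (F : R -> R) : inD P -> inD Q -> inD S ->
  let p := hom P in let q := hom Q in let s := hom S in
  (forall x, F x <= chord_map P x) -> (forall x, F x <= chord_map Q x) ->
  (forall x, F x <= chord_map S x) ->
  lor p p ^ 2 * lor q q ^ 2 * lor s s <= 4 * det3 p q s ^ 2 * lor p q ^ 2 ->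
  exists w, Nat.iter 5 F w <= w + 2.
Proof.
  assert (Hpos : forall P Q S : pt2, inD P -> inD Q -> inD S ->
    (forall x, F x <= chord_map P x) -> (forall x, F x <= chord_map Q x) ->
    (forall x, F x <= chord_map S x) ->
    0 < det3 (hom P) (hom Q) (hom S) ->
    lor (hom P) (hom P) ^ 2 * lor (hom Q) (hom Q) ^ 2 * lor (hom S) (hom S)
      <= 4 * det3 (hom P) (hom Q) (hom S) ^ 2 * lor (hom P) (hom Q) ^ 2 ->
    exists w, Nat.iter 5 F w <= w + 2).
  { clear P Q S. intros P Q S HP HQ HS FP FQ FS HD Hhyp.
    destruct (exists_backward_point P Q S HP HQ HS HD Hhyp) as [t Ht].
    set (w := chord_map P (chord_map Q t)) in *. exists w. simpl.
    assert (HF : forall V x y, inD V -> (forall z, F z <= chord_map V z) ->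
              x <= y -> F x <= chord_map V y).
    { intros V x y HV FV Hxy. apply Rle_trans with (chord_map V x); [apply FV |].
      now apply chord_map_le_iff. }
    assert (H1 : F w <= chord_map Q t + 1).
    { rewrite <- (chord_map_involutive P _ HP). apply HF; auto; apply Rle_refl. }
    assert (H2 : F (F w) <= t + 1 + 1).
    { rewrite <- (chord_map_involutive Q t HQ), <- chord_map_shift. now apply HF. }
    assert (H3 : F (F (F w)) <= chord_map P t + 1 + 1).
    { rewrite <- !chord_map_shift. now apply HF. }
    assert (H4 : F (F (F (F w))) <= chord_map Q (chord_map P t) + 1 + 1).
    { rewrite <- !(chord_map_shift Q). now apply HF. }
    assert (H5 : F (F (F (F (F w)))) <= chord_map S (chord_map Q (chord_map P t)) + 1 + 1).
    { rewrite <- !(chord_map_shift S). now apply HF. }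
    lra. }
  intros HP HQ HS p q s FP FQ FS Hhyp.
  (* A negatively oriented triangle is handled by exchanging [P] and [Q]; a degenerate one
     contradicts the inequality. *)
  destruct (Rtotal_order 0 (det3 p q s)) as [HD | [HD | HD]].
  - now apply (Hpos P Q S).
  - exfalso. rewrite <- HD in Hhyp.
    assert (0 < lor p p ^ 2 * lor q q ^ 2 * lor s s).
    { apply Rmult_lt_0_compat; [apply Rmult_lt_0_compat; apply pow_lt |];
        now apply lor_self_pos. }
    lra.
  - assert (Hsw : det3 q p s = - det3 p q s) by vec_ring.
    apply (Hpos Q P S); try assumption; fold p q s; rewrite Hsw; [lra |].
    rewrite (lor_sym q p). lra.
Qed.

(** * Lower bound *)

(** The quadratic [|P + t (Q - P)|^2 - 1] is negative at [t = 0] and [t = 1], so both parameters lie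
    strictly between its roots. *)
Lemma chord_params (P Q : pt2) : inD P -> inD Q -> P <> Q ->
  let d := sqrt (chord_qb P Q ^ 2 - chord_qa P Q * chord_qc P) in
  let t1 := (- chord_qb P Q - d) / chord_qa P Q in
  let t2 := (- chord_qb P Q + d) / chord_qa P Q in
  0 < chord_qa P Q /\ t1 < 0 /\ 1 < t2 /\
  (forall t, t = t1 \/ t = t2 ->
     fst (chord_pt P Q t) ^ 2 + snd (chord_pt P Q t) ^ 2 = 1).
Proof.
  intros HP HQ HPQ d t1 t2.
  assert (Ha : 0 < chord_qa P Q).
  { destruct P as [p1 p2], Q as [q1 q2]; unfold chord_qa; simpl.
    destruct (Req_dec q1 p1) as [E1 | E1]; [destruct (Req_dec q2 p2) as [E2 | E2] |].
    - exfalso; apply HPQ; congruence.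
    - pose proof (Rsqr_pos_lt (q2 - p2)) as H; unfold Rsqr in H.
      pose proof (pow2_ge_0 (q1 - p1)). lra.
    - pose proof (Rsqr_pos_lt (q1 - p1)) as H; unfold Rsqr in H.
      pose proof (pow2_ge_0 (q2 - p2)). lra. }
  assert (Hc : chord_qc P < 0) by (unfold chord_qc, inD in *; lra).
  assert (Hdd : d ^ 2 = chord_qb P Q ^ 2 - chord_qa P Q * chord_qc P).
  { apply pow2_sqrt. pose proof (pow2_ge_0 (chord_qb P Q)). nra. }
  assert (Hd0 : 0 <= d) by apply sqrt_pos.
  assert (H1 : chord_qa P Q + 2 * chord_qb P Q + chord_qc P < 0).
  { unfold chord_qa, chord_qb, chord_qc, inD in *. lra. }
  set (a := chord_qa P Q) in *. set (b := chord_qb P Q) in *. set (c := chord_qc P) in *.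
  assert (Ht1 : t1 * a = - b - d) by (unfold t1; field; lra).
  assert (Ht2 : t2 * a = - b + d) by (unfold t2; field; lra).
  split; [assumption | split; [| split]].
  - apply Rmult_lt_reg_r with a; [assumption |]. rewrite Ht1.
    apply Rnot_le_lt; intros Hle. nra.
  - apply Rmult_lt_reg_r with a; [assumption |]. rewrite Ht2.
    apply Rnot_le_lt; intros Hle. nra.
  - intros t Ht.
    assert (Hq : a * t ^ 2 + 2 * b * t + c = 0).
    { apply Rmult_eq_reg_r with a; [| lra].
      replace ((a * t ^ 2 + 2 * b * t + c) * a) with ((t * a) ^ 2 + 2 * b * (t * a) + a * c) by ring.
      destruct Ht as [-> | ->]; [rewrite Ht1 | rewrite Ht2]; lra. }
    rewrite <- (Rplus_0_r 1), <- Hq. unfold a, b, c, chord_qa, chord_qb, chord_qc, chord_pt.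
    simpl. ring.
Qed.

(** Barycentric coordinates on the chord; [z < x] records the order [a], [P], [Q], [c] along it. *)
Lemma chord_endpoints_exist (P Q : pt2) : inD P -> inD Q -> P <> Q ->
  exists a c x z, a < c < a + 1 /\ 0 < z < x /\ x < 1 /\
    hom P = vadd (vscal x (hom (circ a))) (vscal (1 - x) (hom (circ c))) /\
    hom Q = vadd (vscal z (hom (circ a))) (vscal (1 - z) (hom (circ c))).
Proof.
  intros HP HQ HPQ.
  destruct (chord_params P Q HP HQ HPQ) as [Ha [Ht1 [Ht2 Hcirc]]].
  set (t1 := (- _ - _) / _) in *. set (t2 := (- _ + _) / _) in *.
  destruct (unit_vector_circ _ _ (Hcirc t1 (or_introl eq_refl))) as [a Ea].
  destruct (unit_vector_circ _ _ (Hcirc t2 (or_intror eq_refl))) as [c0 Ec0].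
  destruct (proj_decomposition (c0 - a)) as [Hb Hdec].
  set (k := Int_part (c0 - a)) in *.
  assert (Ec : circ (a + proj (c0 - a)) = circ c0).
  { rewrite <- (circ_shift_IZR _ k). f_equal. lra. }
  assert (Hne : proj (c0 - a) <> 0).
  { intros E0. rewrite E0, Rplus_0_r, Ea, Ec0 in Ec. unfold chord_pt in Ec. simpl in Ec.
    injection Ec as E1 E2. apply HPQ. destruct P as [p1 p2], Q as [q1 q2]; simpl in *.
    assert (t1 - t2 <> 0) by lra. f_equal.
    - assert ((t1 - t2) * (q1 - p1) = 0) by lra. apply Rmult_integral in H0; lra.
    - assert ((t1 - t2) * (q2 - p2) = 0) by lra. apply Rmult_integral in H0; lra. }
  exists a, (a + proj (c0 - a)), (t2 / (t2 - t1)), ((t2 - 1) / (t2 - t1)).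
  rewrite Ec, Ea, Ec0.
  repeat split; try lra.
  - apply Rdiv_lt_0_compat; lra.
  - apply Rmult_lt_compat_r; [apply Rinv_0_lt_compat |]; lra.
  - apply Rmult_lt_reg_r with (t2 - t1); [lra |].
    unfold Rdiv; rewrite Rmult_assoc, Rinv_l; lra.
  - vec_unfold. f_equal; [f_equal |]; field; lra.
  - vec_unfold. f_equal; [f_equal |]; field; lra.
Qed.

(** With [t = S a] and [u = S c], the orbit of [a] passes [c] and [u], then after two steps [t + 1],
    and finally [S (t + 1) = a + 2]. *)
Lemma iter5_ge_of_star (P Q S : pt2) (F : R -> R) (a c : R) : inD P -> inD Q -> inD S ->
  (forall x y, x <= y -> F x <= F y) ->
  (forall x y, y <= chord_map P x -> y <= chord_map Q x -> y <= chord_map S x -> y <= F x) ->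
  chord_map P a = c -> chord_map Q a = c -> c <= chord_map S a ->
  chord_map Q (chord_map S a) <= chord_map P (chord_map S c) ->
  chord_map P (chord_map S a) <= chord_map Q (chord_map S c) ->
  a + 2 <= Nat.iter 5 F a.
Proof.
  intros HP HQ HS Hmono Hglb EP EQ HcS HQP HPQ.
  assert (EPc : chord_map P c = a + 1) by (rewrite <- EP; now apply chord_map_involutive).
  assert (EQc : chord_map Q c = a + 1) by (rewrite <- EQ; now apply chord_map_involutive).
  assert (Hac : a < c) by (rewrite <- EP; apply chord_map_bounds).
  pose proof (chord_map_bounds S a) as Hbt. pose proof (chord_map_bounds S c) as Hbu.
  set (t := chord_map S a) in *. set (u := chord_map S c) in *.
  assert (ESt : chord_map S t = a + 1) by exact (chord_map_involutive S a HS).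
  assert (ESu : chord_map S u = c + 1) by exact (chord_map_involutive S c HS).
  assert (Htu : t <= u) by (apply chord_map_le_iff; [assumption | lra]).
  assert (Hmn : forall V x y, inD V -> x <= y -> chord_map V x <= chord_map V y)
    by (intros; now apply chord_map_le_iff).
  assert (HuA : u <= a + 1) by (rewrite <- ESt; now apply Hmn).
  assert (H1 : c <= F a) by (apply Hglb; fold t; lra).
  assert (H2 : u <= F c) by (apply Hglb; fold u; lra).
  assert (H3 : t + 1 <= F (F u)).
  (* [F u] is at least one of the three chord images of [u], so two steps of [F] reduce to nine
     compositions. The mixed ones of [P] and [Q] become the two star inequalities after applying an
     involution. *)
  { assert (HFP : forall V y, inD V -> y <= chord_map V (chord_map P u) ->
        y <= chord_map V (chord_map Q u) -> y <= chord_map V (chord_map S u) ->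
        y <= chord_map V (F u)).
    { intros V y HV Y1 Y2 Y3.
      apply Rle_trans with (chord_map V (triangle_map P Q S u)).
      - destruct (triangle_map_cases P Q S u) as [W [[-> | [-> | ->]] ->]]; assumption.
      - apply Hmn; [assumption |].
        destruct (proj1 (triangle_map_glb P Q S u _) (Rle_refl _)) as [? [? ?]].
        now apply Hglb. }
    pose proof (Hmn P _ _ HP Htu) as HmP. pose proof (Hmn Q _ _ HQ Htu) as HmQ.
    apply Hglb; apply HFP; try assumption.
    - rewrite chord_map_involutive by assumption. lra.
    - apply (chord_map_le_iff P); [assumption |].
      rewrite chord_map_involutive, chord_map_shift by assumption. lra.
    - rewrite ESu, chord_map_shift. lra.
    - apply (chord_map_le_iff Q); [assumption |].
      rewrite chord_map_involutive, chord_map_shift by assumption. lra.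
    - rewrite chord_map_involutive by assumption. lra.
    - rewrite ESu, chord_map_shift. lra.
    - unfold t. rewrite <- chord_map_shift. apply Hmn; [assumption |].
      rewrite <- EPc. apply Hmn; [assumption | lra].
    - unfold t. rewrite <- chord_map_shift. apply Hmn; [assumption |].
      rewrite <- EQc. apply Hmn; [assumption | lra].
    - rewrite chord_map_involutive by assumption. lra. }
  assert (H4 : a + 2 <= F (t + 1)).
  { apply Hglb; rewrite chord_map_shift.
    - pose proof (Hmn P c t HP HcS). lra.
    - pose proof (Hmn Q c t HQ HcS). lra.
    - lra. }
  simpl. apply Rle_trans with (F (t + 1)); [exact H4 |]. apply Hmono.
  apply Rle_trans with (F (F u)); [exact H3 |]. apply Hmono, Hmono.
  apply Rle_trans with (F c); [exact H2 |]. now apply Hmono.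
Qed.

(** Here [e] and [e'] are the ends of the line [PQ]. The result factors, and for points in the disk
    with [det3 e e' S >= 0] the last bracket decides a star inequality. *)
Lemma det3_star (e e' S : vec) (x y z w : R) :
  lor e e = 0 -> lor e' e' = 0 ->
  let P := vadd (vscal x e) (vscal y e') in
  let Q := vadd (vscal z e) (vscal w e') in
  det3 (point_reflection S e') (point_reflection Q (point_reflection S e)) P
  = 4 * det3 e e' S * lor Q S *
    (x * w * lor e e' * lor S S - 2 * (x * w - y * z) * lor e S * lor e' S).
Proof.
  intros He He' P Q. rewrite det3_point_reflection.
  assert (HQT : lor Q (point_reflection S e)
    = 2 * lor e S * lor Q S - lor S S * (w * lor e e')).
  { rewrite lor_point_reflection, (lor_sym S e).
    replace (lor Q e) with (z * lor e e + w * lor e e') by (unfold Q; vec_ring).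
    rewrite He. ring. }
  assert (HQQ : lor Q Q = 2 * z * w * lor e e').
  { transitivity (z ^ 2 * lor e e + 2 * z * w * lor e e' + w ^ 2 * lor e' e');
      [unfold Q; vec_ring | rewrite He, He'; ring]. }
  assert (HUQP : det3 (point_reflection S e') Q P
    = - 2 * lor e' S * (x * w - y * z) * det3 e e' S).
  { unfold point_reflection. rewrite (lor_sym S e').
    generalize (lor e' S) (lor S S). unfold P, Q. vec_ring. }
  assert (HUTP : det3 (point_reflection S e') (point_reflection S e) P
    = - 2 * lor S S * det3 e e' S * lor P S).
  { unfold point_reflection. rewrite (lor_sym S e'), (lor_sym S e).
    replace (lor P S) with (x * lor e S + y * lor e' S) by (unfold P; vec_ring).
    generalize (lor e' S) (lor e S) (lor S S). unfold P. vec_ring. }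
  rewrite HQT, HQQ, HUQP, HUTP.
  replace (lor P S) with (x * lor e S + y * lor e' S) by (unfold P; vec_ring).
  replace (lor Q S) with (z * lor e S + w * lor e' S) by (unfold Q; vec_ring).
  ring.
Qed.

(** If [chord_map Q t] does not exceed [u], the bound is immediate; otherwise it lies within one
    turn after [u] and the sign test applies. *)
Lemma chord_map_star_le (P Q : pt2) (t u : R) (T U : vec) : inD P -> inD Q ->
  on_ray t T -> on_ray u U -> t <= u ->
  0 <= det3 U (point_reflection (hom Q) T) (hom P) ->
  chord_map Q t <= chord_map P u.
Proof.
  intros HP HQ HT HU Htu Hdet.
  pose proof (chord_map_bounds P u). pose proof (chord_map_bounds Q u).
  assert (chord_map Q t <= chord_map Q u) by now apply chord_map_le_iff.
  destruct (Rle_lt_dec (chord_map Q t) u); [lra |].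
  apply cross_nonneg_iff; [assumption | lra |].
  apply (det3_nonneg_on_ray P u _ U (point_reflection (hom Q) T)); try assumption.
  now apply on_ray_chord_map.
Qed.

(* The condition compares the translation by [2 |PQ|] with the reflection of the
   line [PQ] in [S], which lies at distance twice the altitude from [PQ]. *)
Lemma exists_iter5_ge (P Q S : pt2) (F : R -> R) : inD P -> inD Q -> inD S -> P <> Q ->
  let p := hom P in let q := hom Q in let s := hom S in
  (forall x y, x <= y -> F x <= F y) ->
  (forall x y, y <= chord_map P x -> y <= chord_map Q x -> y <= chord_map S x -> y <= F x) ->
  4 * det3 p q s ^ 2 * (det3 p q s ^ 2 + gram2 p q * lor s s)
    <= lor p p * lor q q * gram2 p q * lor s s ^ 2 ->
  exists w, w + 2 <= Nat.iter 5 F w.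
Proof.
  assert (Hpos : forall P Q S : pt2, inD P -> inD Q -> inD S -> P <> Q ->
    (forall x y, x <= y -> F x <= F y) ->
    (forall x y, y <= chord_map P x -> y <= chord_map Q x -> y <= chord_map S x -> y <= F x) ->
    0 <= det3 (hom P) (hom Q) (hom S) ->
    4 * det3 (hom P) (hom Q) (hom S) ^ 2 *
      (det3 (hom P) (hom Q) (hom S) ^ 2 + gram2 (hom P) (hom Q) * lor (hom S) (hom S))
      <= lor (hom P) (hom P) * lor (hom Q) (hom Q) * gram2 (hom P) (hom Q)
         * lor (hom S) (hom S) ^ 2 ->
    exists w, w + 2 <= Nat.iter 5 F w).
  { clear P Q S. intros P Q S HP HQ HS HPQ Hmono Hglb HD Hhyp.
    destruct (chord_endpoints_exist P Q HP HQ HPQ)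
      as [a [c [x [z [Hac [Hzx [Hx1 [EP EQ]]]]]]]].
    pose proof (lor_circ_null a) as Hee. pose proof (lor_circ_null c) as Hcc.
    pose proof (lor_circ_pos S a HS) as Heps. pose proof (lor_circ_pos S c HS) as Heps'.
    pose proof (lor_self_pos S HS) as Hrho. pose proof (lor_pos Q S HQ HS) as HqS.
    pose proof (lor_pos P S HP HS) as HpS.
    pose proof (on_ray_circ a) as Ra. pose proof (on_ray_circ c) as Rc.
    pose proof (gram2_pos P Q HP HPQ) as HG.
    assert (Hda : cross (circ a) (circ c) P = 0)
      by (rewrite cross_det3, EP; vec_ring).
    assert (Hdc : cross (circ a) (circ c) Q = 0)
      by (rewrite cross_det3, EQ; vec_ring).
    pose proof (cross_det3 (circ a) (circ c) S) as HcrossS.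
    set (e := hom (circ a)) in *. set (e' := hom (circ c)) in *. set (s := hom S) in *.
    rewrite (lor_sym s e) in Heps. rewrite (lor_sym s e') in Heps'.
    set (kap := lor e e') in *. set (dl := x - z).
    assert (Hdl : 0 < dl) by (unfold dl; lra).
    assert (EG : gram2 (hom P) (hom Q) = dl ^ 2 * kap ^ 2).
    { unfold gram2.
      replace (lor (hom P) (hom Q)) with (x * z * lor e e + (x * (1 - z) + (1 - x) * z) * kap
         + (1 - x) * (1 - z) * lor e' e') by (rewrite EP, EQ; unfold kap; vec_ring).
      replace (lor (hom P) (hom P)) with (x ^ 2 * lor e e + 2 * x * (1 - x) * kap
         + (1 - x) ^ 2 * lor e' e') by (rewrite EP; unfold kap; vec_ring).
      replace (lor (hom Q) (hom Q)) with (z ^ 2 * lor e e + 2 * z * (1 - z) * kap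
         + (1 - z) ^ 2 * lor e' e') by (rewrite EQ; unfold kap; vec_ring).
      rewrite Hee, Hcc. unfold dl. ring. }
    assert (Hkap : 0 < kap).
    { pose proof (lor_self_pos P HP) as HPP.
      replace (lor (hom P) (hom P)) with (x ^ 2 * lor e e + 2 * x * (1 - x) * kap
         + (1 - x) ^ 2 * lor e' e') in HPP by (rewrite EP; unfold kap; vec_ring).
      rewrite Hee, Hcc in HPP. apply Rnot_le_lt; intros Hk.
      assert (0 <= x * (1 - x) * - kap) by (repeat apply Rmult_le_pos; lra). lra. }
    assert (EDet : det3 (hom P) (hom Q) s = dl * det3 e e' s)
      by (rewrite EP, EQ; unfold dl; vec_ring).
    set (d0 := det3 e e' s) in *.
    assert (Hd0 : 0 <= d0) by (rewrite EDet in HD; nra).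
    assert (Hgram : d0 ^ 2 = 2 * kap * lor e s * lor e' s - kap ^ 2 * lor s s).
    { pose proof (gram3 e e' s) as Hg. unfold gram2 in Hg. rewrite Hee, Hcc in Hg.
      fold kap d0 in Hg. lra. }
    assert (Hkey : 2 * dl * lor e s * lor e' s <= x * (1 - z) * kap * lor s s).
    { rewrite EDet, EG in Hhyp.
      replace (lor (hom P) (hom P)) with (x ^ 2 * lor e e + 2 * x * (1 - x) * kap
         + (1 - x) ^ 2 * lor e' e') in Hhyp by (rewrite EP; unfold kap; vec_ring).
      replace (lor (hom Q) (hom Q)) with (z ^ 2 * lor e e + 2 * z * (1 - z) * kap
         + (1 - z) ^ 2 * lor e' e') in Hhyp by (rewrite EQ; unfold kap; vec_ring).
      rewrite Hee, Hcc in Hhyp.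
      set (Z := dl * (2 * lor e s * lor e' s)).
      set (h := kap * lor s s).
      assert (Hh : 0 < h) by now apply Rmult_lt_0_compat.
      assert (HZ : 0 < Z) by (unfold Z; repeat apply Rmult_lt_0_compat; lra).
      (* After division by [4 dl^2 kap^2] the hypothesis is a quadratic inequality in [Z], which
         splits because [x (1 - z) - (1 - x) z = dl]. The second factor is positive. *)
      assert (Hfac : (Z - x * (1 - z) * h) * (Z + (1 - x) * z * h) <= 0).
      { apply Rmult_le_reg_l with (4 * dl ^ 2 * kap ^ 2);
          [repeat apply Rmult_lt_0_compat; lra |].
        rewrite Rmult_0_r. apply Rle_minus in Hhyp. eapply Rle_trans; [| exact Hhyp].
        right.
        transitivity (4 * dl ^ 2 * kap ^ 2 * (Z ^ 2 - dl * h * Z - x * (1 - z) * ((1 - x) * z) * h ^ 2));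
          [unfold dl; ring |].
        replace ((dl * d0) ^ 2) with (dl ^ 2 * d0 ^ 2) by ring. rewrite Hgram.
        unfold Z, h. ring. }
      assert (0 < Z + (1 - x) * z * h).
      { assert (0 < (1 - x) * z * h) by (repeat apply Rmult_lt_0_compat; lra). lra. }
      assert (Z - x * (1 - z) * h <= 0) by (apply Rnot_lt_le; intros Hc; nra).
      unfold Z, h in *. lra. }
    exists a.
    assert (EPa : chord_map P a = c) by now apply chord_map_unique.
    assert (EQa : chord_map Q a = c) by now apply chord_map_unique.
    assert (Hcs : c <= chord_map S a).
    { apply cross_nonneg_iff; [assumption | assumption | now rewrite HcrossS]. }
    assert (Htu : chord_map S a <= chord_map S c) by (apply chord_map_le_iff; [assumption | lra]).
    assert (RT := on_ray_chord_map S a e HS Ra). assert (RU := on_ray_chord_map S c e' HS Rc).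
    fold s in RT, RU.
    apply (iter5_ge_of_star P Q S F a c); try assumption.
    - apply (chord_map_star_le P Q _ _ _ _ HP HQ RT RU Htu).
      rewrite EP, EQ, det3_star by assumption. rewrite <- EQ. fold d0 kap.
      apply Rmult_le_pos; [apply Rmult_le_pos; [lra |]; left; exact HqS |].
      unfold dl in Hkey. lra.
    (* With [P] and [Q] exchanged the difference [x - z] changes sign, so both terms of the bracket
       are nonnegative. *)
    - apply (chord_map_star_le Q P _ _ _ _ HQ HP RT RU Htu).
      rewrite EP, EQ, det3_star by assumption. rewrite <- EP. fold d0 kap.
      apply Rmult_le_pos; [apply Rmult_le_pos; [lra |]; left; exact HpS |].
      assert (0 <= z * (1 - x) * kap * lor s s) by (repeat apply Rmult_le_pos; lra).
      assert (0 <= (x - z) * lor e s * lor e' s) by (repeat apply Rmult_le_pos; lra).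
      lra. }
  intros HP HQ HS HPQ p q s Hmono Hglb Hhyp.
  destruct (Rle_lt_dec 0 (det3 p q s)) as [HD | HD].
  - now apply (Hpos P Q S).
  - assert (Hsw : det3 q p s = - det3 p q s) by vec_ring.
    assert (HGs : gram2 q p = gram2 p q) by (unfold gram2; rewrite (lor_sym q p); ring).
    apply (Hpos Q P S); auto; fold p q s; rewrite Hsw; [lra |].
    rewrite HGs, (Rmult_comm (lor q q)).
    replace ((- det3 p q s) ^ 2) with (det3 p q s ^ 2) by ring. exact Hhyp.
Qed.

(** * Hyperbolic distances *)

Lemma cosh_sq (x : R) : cosh x ^ 2 = 1 + sinh x ^ 2.
Proof.
  unfold cosh, sinh. pose proof (exp_pos x). rewrite exp_Ropp. field. lra.
Qed.

Lemma sinh_2a (x : R) : sinh (2 * x) = 2 * sinh x * cosh x.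
Proof.
  unfold cosh, sinh. replace (2 * x) with (x + x) by ring.
  rewrite !exp_Ropp, exp_plus. pose proof (exp_pos x). field. lra.
Qed.

Lemma sinh_le (x y : R) : x <= y -> sinh x <= sinh y.
Proof. intros [H | ->]; [left; now apply sinh_lt | lra]. Qed.

Lemma sinh_nonneg (x : R) : 0 <= x -> 0 <= sinh x.
Proof. rewrite <- sinh_0 at 2. apply sinh_le. Qed.

Lemma cosh_sq_le_iff (x y : R) : 0 <= x -> 0 <= y -> cosh x ^ 2 <= cosh y ^ 2 <-> x <= y.
Proof.
  intros Hx Hy. rewrite !cosh_sq. pose proof (sinh_nonneg x Hx). pose proof (sinh_nonneg y Hy).
  split; intros Hxy.
  - apply Rnot_lt_le; intros Hlt. apply sinh_lt in Hlt. nra.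
  - apply sinh_le in Hxy. nra.
Qed.

(** The fraction is [coth (x / 2)]. This turns bounds by [Deltap] into bounds on products of
    hyperbolic sines. *)
Lemma sinh_log_coth (x : R) : 0 < x ->
  0 < sinh x /\ sinh (ln ((exp x + 1) / (exp x - 1))) * sinh x = 1.
Proof.
  intros Hx. assert (H1 : 1 < exp x) by (rewrite <- exp_0; now apply exp_increasing).
  split; [rewrite <- sinh_0; now apply sinh_lt |].
  unfold sinh. rewrite !exp_Ropp, exp_ln by (apply Rdiv_lt_0_compat; lra).
  field. repeat split; nra.
Qed.

Lemma log_coth_le (x h : R) : 0 < x ->
  ln ((exp x + 1) / (exp x - 1)) <= h -> 1 <= sinh h * sinh x.
Proof.
  intros Hx Hh. destruct (sinh_log_coth x Hx) as [Hs E]. apply sinh_le in Hh.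
  rewrite <- E. apply Rmult_le_compat_r; lra.
Qed.

Lemma log_coth_ge (x h : R) : 0 < x ->
  h <= ln ((exp x + 1) / (exp x - 1)) -> sinh h * sinh x <= 1.
Proof.
  intros Hx Hh. destruct (sinh_log_coth x Hx) as [Hs E]. apply sinh_le in Hh.
  rewrite <- E. apply Rmult_le_compat_r; lra.
Qed.

(** * Distances and altitudes in Lorentzian terms *)

Lemma edist_chord_pt (P Q : pt2) (t t' : R) :
  edist (chord_pt P Q t) (chord_pt P Q t') = Rabs (t - t') * sqrt (chord_qa P Q).
Proof.
  unfold edist, chord_pt; simpl fst; simpl snd.
  rewrite <- sqrt_Rsqr_abs, <- sqrt_mult_alt by apply Rle_0_sqr.
  f_equal. unfold chord_qa, Rsqr. ring.
Qed.

Lemma chord_pt_0 (P Q : pt2) : chord_pt P Q 0 = P.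
Proof. destruct P; unfold chord_pt; simpl; f_equal; ring. Qed.

Lemma chord_pt_1 (P Q : pt2) : chord_pt P Q 1 = Q.
Proof. destruct Q; unfold chord_pt; simpl; f_equal; ring. Qed.

(** In terms of the chord parameters [t1] and [t2] of the endpoints, the cross ratio is
    [n1 / n2 = exp (2 d)], whence [cosh d ^ 2 = (n1 + n2)^2 / (4 n1 n2)]. The Lorentz products are
    expressed in [t1] and [t2] by Vieta. *)
Lemma dprime_spec (P Q : pt2) : inD P -> inD Q ->
  0 <= dprime P Q /\
  cosh (dprime P Q) ^ 2 * (lor (hom P) (hom P) * lor (hom Q) (hom Q)) = lor (hom P) (hom Q) ^ 2.
Proof.
  intros HP HQ.
  assert (Hdec : (P = Q /\ dprime P Q = 0) \/ (P <> Q /\ dprime P Q =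
    / 2 * Rabs (ln ((edist (chord_end1 P Q) Q * edist (chord_end2 P Q) P)
                    / (edist (chord_end1 P Q) P * edist (chord_end2 P Q) Q))))).
  { unfold dprime.
    destruct (Req_EM_T (fst P) (fst Q)) as [E1 | E1];
      [destruct (Req_EM_T (snd P) (snd Q)) as [E2 | E2] |].
    - left; split; [| reflexivity].
      destruct P, Q; simpl in *; congruence.
    - right; split; [congruence | reflexivity].
    - right; split; [congruence | reflexivity]. }
  destruct Hdec as [[-> ->] | [HPQ ->]].
  { split; [lra |]. rewrite cosh_0. ring. }
  destruct (chord_params P Q HP HQ HPQ) as [Ha [Ht1 [Ht2 Hc]]].
  unfold chord_end1, chord_end2.
  set (t1 := (- _ - _) / _) in *. set (t2 := (- _ + _) / _) in *.
  set (a := chord_qa P Q) in *.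
  assert (Hsa : 0 < sqrt a) by now apply sqrt_lt_R0.
  assert (HdQ : forall t, edist (chord_pt P Q t) Q = Rabs (t - 1) * sqrt a).
  { intros t. rewrite <- (chord_pt_1 P Q) at 2. apply edist_chord_pt. }
  assert (HdP : forall t, edist (chord_pt P Q t) P = Rabs (t - 0) * sqrt a).
  { intros t. rewrite <- (chord_pt_0 P Q) at 2. apply edist_chord_pt. }
  rewrite !HdQ, !HdP.
  rewrite (Rabs_left (t1 - 1)), (Rabs_left (t1 - 0)), (Rabs_pos_eq (t2 - 0)),
    (Rabs_pos_eq (t2 - 1)) by lra.
  set (n1 := (1 - t1) * t2). set (n2 := - t1 * (t2 - 1)).
  assert (Hn2 : 0 < n2) by (unfold n2; apply Rmult_lt_0_compat; lra).
  assert (Hn12 : n2 < n1) by (unfold n1, n2; lra).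
  replace (- (t1 - 1) * sqrt a * ((t2 - 0) * sqrt a)
           / (- (t1 - 0) * sqrt a * ((t2 - 1) * sqrt a)))
    with (n1 / n2) by (unfold n1, n2; field; repeat split; lra).
  assert (HX : 1 < n1 / n2).
  { apply Rmult_lt_reg_r with n2; [assumption |].
    unfold Rdiv; rewrite Rmult_assoc, Rinv_l; lra. }
  assert (Hln : 0 < ln (n1 / n2)) by (rewrite <- ln_1; apply ln_increasing; lra).
  rewrite Rabs_pos_eq by lra. split; [lra |].
  set (d := / 2 * ln (n1 / n2)).
  assert (Hexp : exp d ^ 2 = n1 / n2).
  { rewrite <- (exp_ln (n1 / n2)) by lra. simpl. rewrite Rmult_1_r, <- exp_plus.
    f_equal. unfold d. lra. }
  assert (Hcosh : cosh d ^ 2 = (n1 + n2) ^ 2 / (4 * n1 * n2)).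
  { unfold cosh. rewrite exp_Ropp. pose proof (exp_pos d).
    transitivity ((exp d ^ 2 + 2 + / (exp d ^ 2)) / 4); [field; lra |].
    rewrite Hexp. field. lra. }
  pose proof (Hc t1 (or_introl eq_refl)) as Hc1. pose proof (Hc t2 (or_intror eq_refl)) as Hc2.
  set (b := chord_qb P Q) in *. set (c := chord_qc P) in *.
  assert (Hq1 : a * t1 ^ 2 + 2 * b * t1 + c = 0).
  { unfold a, b, c, chord_qa, chord_qb, chord_qc, chord_pt in *. simpl in Hc1. simpl. lra. }
  assert (Hq2 : a * t2 ^ 2 + 2 * b * t2 + c = 0).
  { unfold a, b, c, chord_qa, chord_qb, chord_qc, chord_pt in *. simpl in Hc2. simpl. lra. }
  (* Vieta: the two quadratic equations are subtracted and [t1 - t2] is cancelled. *)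
  assert (Hb : 2 * b = - a * (t1 + t2)).
  { apply Rmult_eq_reg_l with (t1 - t2); [| lra]. lra. }
  assert (Hcc : c = a * (t1 * t2)).
  { replace c with (- a * t1 ^ 2 - (2 * b) * t1) by lra. rewrite Hb. ring. }
  assert (EA : lor (hom P) (hom P) = - c) by (unfold c, chord_qc; vec_ring).
  assert (EC : lor (hom Q) (hom Q) = - (a + 2 * b + c))
    by (unfold a, b, c, chord_qa, chord_qb, chord_qc; vec_ring).
  assert (EB : lor (hom P) (hom Q) = - c - (2 * b) / 2)
    by (unfold b, c, chord_qb, chord_qc; vec_unfold; field).
  rewrite Hcosh, EA, EC, EB, Hb, Hcc.
  transitivity ((n1 + n2) ^ 2 / (4 * n1 * n2) * (a ^ 2 * (n1 * n2)));
    [f_equal; unfold n1, n2; ring |].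
  transitivity (a ^ 2 * (n1 + n2) ^ 2 / 4); [field; lra |].
  unfold n1, n2; field.
Qed.

Lemma dprime_pos (P Q : pt2) : inD P -> inD Q -> P <> Q -> 0 < dprime P Q.
Proof.
  intros HP HQ HPQ. destruct (dprime_spec P Q HP HQ) as [H0 E].
  destruct H0 as [H0 | H0]; [assumption | exfalso].
  rewrite <- H0, cosh_0 in E. pose proof (gram2_pos P Q HP HPQ) as HG.
  unfold gram2 in HG. lra.
Qed.

(* Lorentzian form of "the perpendicular is the shortest segment". *)
Lemma altitude_le (X Y Z : vec) (k l : R) :
  let W := vadd (vscal k X) (vscal l Y) in
  (det3 X Y Z ^ 2 + gram2 X Y * lor Z Z) * lor W W <= lor Z W ^ 2 * gram2 X Y.
Proof.
  intros W. rewrite <- gram3.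
  (* The left side of the claim minus the right is minus this square, which vanishes when [W] is
     proportional to the orthogonal projection of [Z] on the span of [X] and [Y]. *)
  assert (0 <= (k * (lor X Z * lor X Y - lor Y Z * lor X X)
                - l * (lor Y Z * lor X Y - lor X Z * lor Y Y)) ^ 2) as H by apply pow2_ge_0.
  replace (lor W W) with (k ^ 2 * lor X X + 2 * k * l * lor X Y + l ^ 2 * lor Y Y)
    by (unfold W; vec_ring).
  replace (lor Z W) with (k * lor X Z + l * lor Y Z) by (unfold W; vec_ring).
  unfold gram2. apply Rminus_le.
  match goal with |- ?lhs <= 0 => replace lhs with
    (- (k * (lor X Z * lor X Y - lor Y Z * lor X X)
                - l * (lor Y Z * lor X Y - lor X Z * lor Y Y)) ^ 2) by ring end.
  lra.
Qed.

Lemma hom_chord_pt (P Q : pt2) (t : R) :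
  hom (chord_pt P Q t) = vadd (vscal (1 - t) (hom P)) (vscal t (hom Q)).
Proof. unfold chord_pt; vec_unfold; f_equal; [f_equal |]; ring. Qed.

Lemma cosh_dprime_chord_ge (P Q S T : pt2) : inD P -> inD Q -> inD S -> P <> Q ->
  on_chord P Q T ->
  det3 (hom P) (hom Q) (hom S) ^ 2 + gram2 (hom P) (hom Q) * lor (hom S) (hom S)
  <= cosh (dprime S T) ^ 2 * (gram2 (hom P) (hom Q) * lor (hom S) (hom S)).
Proof.
  intros HP HQ HS HPQ [HT [t Et]].
  destruct (dprime_spec S T HS HT) as [_ E].
  pose proof (gram2_pos P Q HP HPQ) as HG. pose proof (lor_self_pos T HT) as HTT.
  pose proof (altitude_le (hom P) (hom Q) (hom S) (1 - t) t) as H. cbv zeta in H.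
  rewrite <- hom_chord_pt, <- Et, <- E in H.
  apply Rmult_le_reg_r with (lor (hom T) (hom T)); [assumption |]. lra.
Qed.

Lemma foot_exists (P Q S : pt2) : inD P -> inD Q -> inD S -> P <> Q ->
  exists T, on_chord P Q T /\
  cosh (dprime S T) ^ 2 * (gram2 (hom P) (hom Q) * lor (hom S) (hom S))
  = det3 (hom P) (hom Q) (hom S) ^ 2 + gram2 (hom P) (hom Q) * lor (hom S) (hom S).
Proof.
  intros HP HQ HS HPQ. pose proof (gram2_pos P Q HP HPQ) as HG.
  pose proof (lor_self_pos S HS) as Hrho.
  rewrite <- gram3.
  set (p := hom P) in *. set (q := hom Q) in *. set (s := hom S) in *.
  set (E := 2 * _ * _ * _ - _ - _).
  assert (HE : 0 < E).
  { unfold E. rewrite gram3. pose proof (pow2_ge_0 (det3 p q s)).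
    assert (0 < gram2 p q * lor s s) by now apply Rmult_lt_0_compat. lra. }
  (* With these coefficients [v] is [gram2 p q] times the Lorentz-orthogonal projection of [s] on
     the span of [p] and [q]. *)
  set (k := lor p q * lor q s - lor p s * lor q q).
  set (l := lor p q * lor p s - lor q s * lor p p).
  set (v := vadd (vscal k p) (vscal l q)).
  assert (Hvv : lor v v = gram2 p q * E).
  { transitivity (k ^ 2 * lor p p + 2 * k * l * lor p q + l ^ 2 * lor q q);
      [unfold v; vec_ring | unfold k, l, E, gram2; ring]. }
  assert (Hsv : lor s v = E).
  { transitivity (k * lor p s + l * lor q s); [unfold v; vec_ring | unfold k, l, E; ring]. }
  assert (Hvpos : 0 < lor v v) by (rewrite Hvv; now apply Rmult_lt_0_compat).
  (* [v] is timelike, so its last coordinate [k + l] cannot vanish, and dividing by it gives a point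
     of the disk. *)
  assert (Hkl : k + l <> 0).
  { intros H0. assert (Hz : vz v = 0) by (unfold v, p, q; vec_unfold; lra).
    unfold lor in Hvpos. rewrite Hz in Hvpos. nra. }
  assert (Hhom : hom (chord_pt P Q (l / (k + l))) = vscal (/ (k + l)) v).
  { rewrite hom_chord_pt. unfold v. fold p q. unfold vadd, vscal, vx, vy, vz; simpl.
    f_equal; [f_equal |]; field; assumption. }
  set (T := chord_pt P Q (l / (k + l))) in *.
  assert (Hk2 : 0 < (/ (k + l)) ^ 2).
  { assert (/ (k + l) <> 0) by now apply Rinv_neq_0_compat.
    pose proof (Rsqr_pos_lt _ H) as Hp. unfold Rsqr in Hp. lra. }
  assert (HTT : lor (hom T) (hom T) = (/ (k + l)) ^ 2 * (gram2 p q * E)).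
  { rewrite Hhom, <- Hvv. vec_ring. }
  assert (HTS : lor s (hom T) = / (k + l) * E).
  { rewrite Hhom, <- Hsv. vec_ring. }
  assert (HTpos : 0 < lor (hom T) (hom T)).
  { rewrite HTT. rewrite <- Hvv. now apply Rmult_lt_0_compat. }
  assert (HTD : inD T) by now apply inD_of_lor_self_pos.
  exists T. split; [split; [assumption | now exists (l / (k + l))] |].
  destruct (dprime_spec S T HS HTD) as [_ Ec]. fold s in Ec. rewrite HTS, HTT in Ec.
  apply Rmult_eq_reg_r with ((/ (k + l)) ^ 2 * E); [| apply Rgt_not_eq; now apply Rmult_lt_0_compat].
  lra.
Qed.

(** The foot of the perpendicular attains the minimum, so the choice in [delta] is meaningful. The
    formula amounts to [sinh h ^ 2 * gram2 * lor S S = det3 ^ 2], where [h] is [delta P Q S]. *)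
Lemma delta_spec (P Q S : pt2) : inD P -> inD Q -> inD S -> P <> Q ->
  0 <= delta P Q S /\
  cosh (delta P Q S) ^ 2 * (gram2 (hom P) (hom Q) * lor (hom S) (hom S))
  = det3 (hom P) (hom Q) (hom S) ^ 2 + gram2 (hom P) (hom Q) * lor (hom S) (hom S).
Proof.
  intros HP HQ HS HPQ.
  assert (HGr : 0 < gram2 (hom P) (hom Q) * lor (hom S) (hom S))
    by (apply Rmult_lt_0_compat; [now apply gram2_pos | now apply lor_self_pos]).
  destruct (foot_exists P Q S HP HQ HS HPQ) as [T [HT ET]].
  assert (Hd0 : forall T', on_chord P Q T' -> 0 <= dprime S T')
    by (intros T' [HT' _]; now apply dprime_spec).
  assert (Hmin : is_min_dist P Q S (delta P Q S)).
  { unfold delta. apply epsilon_spec. exists (dprime S T). split; [now exists T |].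
    intros T' HT'. apply cosh_sq_le_iff; [auto | auto |].
    apply Rmult_le_reg_r with (1 := HGr). rewrite ET. now apply cosh_dprime_chord_ge. }
  destruct Hmin as [[T0 [HT0 <-]] Hle]. split; [auto |].
  apply Rle_antisym; [| now apply cosh_dprime_chord_ge].
  rewrite <- ET. apply Rmult_le_compat_r; [lra |]. apply cosh_sq_le_iff; auto.
Qed.

Theorem theorem4p9 (P Q R0 : pt2) :
  inD P -> inD Q -> inD R0 -> P <> Q ->
  ((Deltap 2%nat P Q <= delta P Q R0 <= / 2 * Deltap 1%nat P Q) \/
   (/ 2 * Deltap 1%nat P Q <= delta P Q R0 <= Deltap 2%nat P Q)) ->
  rotation_number_is (psi (filled_triangle P Q R0)) (2 / 5).
Proof.
  intros HP HQ HR HPQ Hyp.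
  destruct (dprime_spec P Q HP HQ) as [Hd0 Ed].
  pose proof (dprime_pos P Q HP HQ HPQ) as Hd.
  destruct (delta_spec P Q R0 HP HQ HR HPQ) as [Hdl0 Edl].
  unfold Deltap in Hyp. change (INR 2) with 2 in Hyp. change (INR 1) with 1 in Hyp.
  rewrite Rmult_1_l in Hyp.
  set (d := dprime P Q) in *. set (h := delta P Q R0) in *.
  rewrite cosh_sq in Ed, Edl.
  pose proof (lor_self_pos P HP) as HA. pose proof (lor_self_pos Q HQ) as HC.
  pose proof (lor_self_pos R0 HR) as Hrho. pose proof (gram2_pos P Q HP HPQ) as HG.
  set (F := triangle_map P Q R0).
  assert (Fmono : forall x y, x <= y -> F x <= F y) by (intros; now apply triangle_map_le).
  assert (Fle : forall x, F x <= chord_map P x /\ F x <= chord_map Q x /\ F x <= chord_map R0 x)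
    by (intros x; apply triangle_map_glb; apply Rle_refl).
  assert (Fglb : forall x y, y <= chord_map P x -> y <= chord_map Q x ->
            y <= chord_map R0 x -> y <= F x) by (intros; now apply triangle_map_glb).
  assert (Hbounds : (exists w, Nat.iter 5 F w <= w + 2) /\ (exists w, w + 2 <= Nat.iter 5 F w)).
  2: { destruct Hbounds as [[a Ha] [b Hb]].
       replace (2 / 5) with (INR 2 / INR 5) by (simpl; field).
       apply (rotation_number_triangle P Q R0 5 2 a b); try assumption; lia. }
  set (p := hom P) in *. set (q := hom Q) in *. set (r := hom R0) in *.
  pose proof (sinh_nonneg d Hd0) as Hsd. pose proof (sinh_nonneg h Hdl0) as Hsh.
  pose proof (cosh_sq d) as Hcd. pose proof (cosh_sq h) as Hch.
  pose proof (sinh_2a d) as H2d. pose proof (sinh_2a h) as H2h.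
  set (A := lor p p) in *. set (C := lor q q) in *. set (rho := lor r r) in *.
  set (D := det3 p q r) in *. set (G := gram2 p q) in *.
  assert (EG : sinh d ^ 2 * (A * C) = G) by (unfold G, gram2; fold A C; lra).
  assert (ED : D ^ 2 = sinh h ^ 2 * (G * rho)) by lra.
  (* The next two identities turn the criterion of [exists_iter5_le] for the side [PQ] into
     [N1 >= 1] and that of [exists_iter5_ge] into [N2 <= 1], with [N1 = sinh h sinh (2 d)] and
     [N2 = sinh (2 h) sinh d]. *)
  assert (EDb : 4 * D ^ 2 * lor p q ^ 2
      = (sinh h * sinh (2 * d)) ^ 2 * (A ^ 2 * C ^ 2 * rho)).
  { rewrite ED, <- Ed, <- EG, H2d, <- Hcd. ring. }
  assert (EDE : 4 * D ^ 2 * (D ^ 2 + G * rho)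
      = (sinh (2 * h) * sinh d) ^ 2 * (A * C * G * rho ^ 2)).
  { rewrite <- Edl, ED, H2h, <- Hch. rewrite <- EG at 1. ring. }
  assert (H2d0 : 0 <= sinh (2 * d)) by (apply sinh_nonneg; lra).
  assert (H2h0 : 0 <= sinh (2 * h)) by (apply sinh_nonneg; lra).
  set (N1 := sinh h * sinh (2 * d)) in *. set (N2 := sinh (2 * h) * sinh d) in *.
  assert (HN1 : 0 <= N1) by now apply Rmult_le_pos.
  assert (HN2 : 0 <= N2) by now apply Rmult_le_pos.
  assert (Hk1 : 0 < A ^ 2 * C ^ 2 * rho)
    by (apply Rmult_lt_0_compat; [apply Rmult_lt_0_compat; now apply pow_lt | assumption]).
  assert (Hk2 : 0 < A * C * G * rho ^ 2)
    by (apply Rmult_lt_0_compat; [repeat apply Rmult_lt_0_compat; assumption | now apply pow_lt]).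
  destruct Hyp as [[Hlo Hhi] | [Hlo Hhi]].
  - assert (H1 : 1 <= N1) by (apply log_coth_le; lra).
    assert (H2 : N2 <= 1) by (apply log_coth_ge; lra).
    split.
    + apply (exists_iter5_le P Q R0); try assumption; try (intros x; apply Fle).
      fold p q r A C rho D. rewrite EDb.
      rewrite <- (Rmult_1_l (A ^ 2 * C ^ 2 * rho)) at 1.
      apply Rmult_le_compat_r; [lra | nra].
    + apply (exists_iter5_ge P Q R0); try assumption.
      fold p q r A C rho D G. rewrite EDE.
      rewrite <- (Rmult_1_l (A * C * G * rho ^ 2)) at 2.
      apply Rmult_le_compat_r; [lra | nra].
  - assert (H1 : N1 <= 1) by (apply log_coth_ge; lra).
    assert (H2 : 1 <= N2) by (apply log_coth_le; lra).
    split.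
    (* [cosh |QR| >= cosh h] since the altitude is the shortest segment. *)
    + apply (exists_iter5_le R0 Q P); try assumption; try (intros x; apply Fle).
      fold p q r A C rho.
      assert (Halt : (D ^ 2 + G * rho) * C <= lor r q ^ 2 * G).
      { pose proof (altitude_le p q r 0 1) as Hal. cbv zeta in Hal.
        replace (vadd (vscal 0 p) (vscal 1 q)) with q in Hal
          by (unfold q; vec_unfold; f_equal; [f_equal |]; ring).
        exact Hal. }
      replace (det3 r q p ^ 2) with (D ^ 2) by (unfold D; vec_ring).
      apply Rmult_le_reg_r with G; [assumption |].
      (* The first inequality is [N2 >= 1]; the second replaces the altitude by the side [QR]
         through [Halt]. *)
      apply Rle_trans with (4 * D ^ 2 * (D ^ 2 + G * rho) * C).
      * rewrite EDE.
        replace (rho ^ 2 * C ^ 2 * A * G) with (1 * (A * C * G * rho ^ 2) * C) by ring.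
        apply Rmult_le_compat_r; [lra |]. apply Rmult_le_compat_r; [lra |]. nra.
      * assert (0 <= 4 * D ^ 2) by (pose proof (pow2_ge_0 D); lra). nra.
    (* [N2 >= 1] forces [h > 0], so the triangle is not degenerate and [R0 P] is a genuine side. *)
    + assert (HD : 0 < D ^ 2).
      { rewrite ED. assert (0 < sinh h).
        { destruct Hsh as [Hs | Hs]; [assumption |]. exfalso.
          unfold N2 in H2. rewrite H2h, <- Hs in H2. lra. }
        apply Rmult_lt_0_compat; [now apply pow_lt | now apply Rmult_lt_0_compat]. }
      assert (HRP : R0 <> P).
      { intros E. unfold D, r in HD. rewrite E in HD. fold p in HD.
        replace (det3 p q p) with 0 in HD by vec_ring. lra. }
      pose proof (gram2_pos R0 P HR HRP) as HG'. fold p r in HG'.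
      (* The altitude from [Q] is at most [|QP|]. *)
      assert (Halt : (D ^ 2 + gram2 r p * C) * A <= lor p q ^ 2 * gram2 r p).
      { pose proof (altitude_le r p q 0 1) as Hal. cbv zeta in Hal.
        replace (vadd (vscal 0 r) (vscal 1 p)) with p in Hal
          by (unfold p; vec_unfold; f_equal; [f_equal |]; ring).
        replace (det3 r p q) with D in Hal by (unfold D; vec_ring).
        rewrite (lor_sym q p) in Hal. exact Hal. }
      apply (exists_iter5_ge R0 P Q); try assumption; [intros; now apply Fglb |].
      fold p q r A C rho. replace (det3 r p q) with D by (unfold D; vec_ring).
      apply Rmult_le_reg_r with A; [assumption |].
      (* Here [Halt] comes first, and [N1 <= 1] then closes the bound. *)
      apply Rle_trans with (4 * D ^ 2 * lor p q ^ 2 * gram2 r p).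
      * nra.
      * rewrite EDb.
        replace (rho * A * gram2 r p * C ^ 2 * A) with (1 * (A ^ 2 * C ^ 2 * rho) * gram2 r p) by ring.
        apply Rmult_le_compat_r; [lra |]. apply Rmult_le_compat_r; [lra |]. nra.
Qed.
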